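(* Let $E\subseteq\Gamma$ be a set of multiplicity. Then there exists a nonzero distribution $\mu$ on $\Gamma$ whose support is a Kronecker set contained in $E$ and such that $\hat\mu(n)\to0$ as $n\to-\infty$.
   Context: $\Gamma$ is the unit circle; distributions on $\Gamma$ have Fourier coefficients $\hat\mu(n)=\langle\mu, e^{-int}\rangle$, $n\in\mathbb Z$. A closed set $E\subseteq\Gamma$ is a set of multiplicity if there is a nonzero distribution $S$ supported by $E$ with $\hat S(n)\to0$ as $|n|\to\infty$. A Kronecker set is a closed $K\subseteq\Gamma$ such that every continuous $u:K\to\Gamma$ is a uniform limit on $K$ of functions $z\mapsto z^n$, $n\in\mathbb Z$. *)

(* Defs.v *)
From Stdlib Require Import Reals ZArith Lia.
From Coquelicot Require Import Coquelicot.
Open Scope R_scope.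

Definition on_circle (z : C) : Prop := Cmod z = 1.

Definition eit (t : R) : C := (cos t, sin t).

Definition Zpow (z : C) (n : Z) : C :=
  match n with
  | Z0 => RtoC 1
  | Zpos p => Cpow z (Pos.to_nat p)
  | Zneg p => Cpow (Cinv z) (Pos.to_nat p)
  end.

(** Test functions: C^infinity functions on Gamma, written as 2pi-periodic
    smooth functions of the angle t (real-valued; complex test functions are
    pairs of these, and distributions extend C-linearly). *)
Definition test_fun (phi : R -> R) : Prop :=
  (forall t, phi (t + 2 * PI) = phi t) /\
  (forall (k : nat) (t : R), ex_derive_n phi k t).

(** A distribution on Gamma: a (complex-valued) linear functional on test
    functions, continuous for the C^infinity topology, i.e. bounded by a
    constant times the sup of the first k derivatives. *)
Definition is_distribution (S : (R -> R) -> C) : Prop :=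
  (forall (phi psi : R -> R) (a b : R), test_fun phi -> test_fun psi ->
     S (fun t => a * phi t + b * psi t) = Cplus (Cmult (RtoC a) (S phi)) (Cmult (RtoC b) (S psi)))
  /\ exists (K : R) (k : nat), forall (phi : R -> R) (M : R), test_fun phi ->
       (forall (j : nat) (t : R), (j <= k)%nat -> Rabs (Derive_n phi j t) <= M) ->
       Cmod (S phi) <= K * M.

Definition nonzero_distr (S : (R -> R) -> C) : Prop :=
  exists phi, test_fun phi /\ S phi <> RtoC 0.

(** Fourier coefficient  S^(n) = < S, e^{-int} > = S(cos(n.)) - i S(sin(n.)). *)
Definition fourier (S : (R -> R) -> C) (n : Z) : C :=
  Cminus (S (fun t => cos (IZR n * t))) (Cmult Ci (S (fun t => sin (IZR n * t)))).

Definition supp (S : (R -> R) -> C) (z : C) : Prop :=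
  on_circle z /\
  forall eps : R, 0 < eps ->
    exists phi, test_fun phi /\
      (forall t, eps <= Cmod (Cminus (eit t) z) -> phi t = 0) /\
      S phi <> RtoC 0.

Definition supported_by (S : (R -> R) -> C) (E : C -> Prop) : Prop :=
  forall z, supp S z -> E z.

Definition closed_subset_circle (E : C -> Prop) : Prop :=
  closed E /\ forall z, E z -> on_circle z.

Definition multiplicity_set (E : C -> Prop) : Prop :=
  closed_subset_circle E /\
  exists S, is_distribution S /\ nonzero_distr S /\ supported_by S E /\
    forall eps : R, 0 < eps -> exists N : nat, forall n : Z,
      (Z.of_nat N < Z.abs n)%Z -> Cmod (fourier S n) < eps.

Definition kronecker_set (K : C -> Prop) : Prop :=
  closed_subset_circle K /\
  forall u : C -> C,
    (forall z, K z -> on_circle (u z)) ->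
    (forall z, K z -> forall eps : R, 0 < eps -> exists delta : R, 0 < delta /\
       forall w, K w -> Cmod (Cminus w z) < delta -> Cmod (Cminus (u w) (u z)) < eps) ->
    forall eps : R, 0 < eps -> exists n : Z,
      forall z, K z -> Cmod (Cminus (u z) (Zpow z n)) < eps.

(* Main.v *)
Require Import Defs.
From Stdlib Require Import Reals ZArith Lra Lia Psatz.
From Stdlib Require Import Cantor Classical ClassicalEpsilon FunctionalExtensionality List.
From Coquelicot Require Import Coquelicot.
Open Scope R_scope.

(** Start from the given [S], whose coefficients tend to 0 at both ends, and multiply it successively by smooth
    functions [h_j], each forcing the support into a set where some power [z^n] is close to one of countably many
    step functions, dense among the continuous maps to the circle; the limit [mu] then has a Kronecker support.
    The factor is built from a function [F] on the circle, supported near 1, of the form [1 + P - r], with [P] a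
    polynomial in [z] vanishing at 0 and [r] small in C^3: it is an analytic polynomial with constant term 1,
    tiny off a neighbourhood of 1, which has been cut off there.  In [F(w z^n) S] the part [P(w z^n) S] only
    involves the coefficients of [S] translated by at least [n] to the right, so for large [n] it is uniformly
    small on negative frequencies, while on positive frequencies it may be large, but only from about [n] on,
    hence at most [eps * (1 + |m|)].  So the products converge as distributions, and the negative coefficients
    converge uniformly. *)

(** * Smooth periodic functions *)

(** A function [F] vanishing on an arc cannot have all coefficients of [F - 1] small: testing
    against a function carried by that arc shows it. So one side must be sacrificed, and Runge's
    phenomenon makes this possible: a closed arc omitting 1 does not separate 0 from infinity, hence
    -1 is a uniform limit on it of polynomials in [z] vanishing at 0. A suitable multiple of the
    analytic half of the Fejer kernel gives [|1 + P| < 1] there, and powers do the rest. The order 3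
    that recurs below is forced by the allowance [eps * (1 + |m|)]: coefficients of a C^3 function
    are O(|m|^-3), and against linear growth this leaves the convergent series of [m^-2]. The bounds
    obtained depend only on the size of the coefficients, not on the order of the distribution,
    which is why geometrically small errors can be summed. The limit is nonzero because the errors
    are scaled so that one chosen nonzero coefficient of [S] loses at most half of its modulus.
    Different arcs of the circle need different rotations [w]; a partition of unity separates them,
    and one exponent [n] serves all arcs because the thresholds do not depend on [w]. *)

Definition has_deriv (f : R -> C) (t : R) (l : C) : Prop :=
  is_derive (fun x => fst (f x)) t (fst l) /\ is_derive (fun x => snd (f x)) t (snd l).

Definition D (f : R -> C) : R -> C :=
  fun t => (Derive (fun x => fst (f x)) t, Derive (fun x => snd (f x)) t).

(** The innermost derivative is taken first, so that inductions generalize over [f]; [Dn_out]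
    supplies the other recursion. *)
Fixpoint Dn (n : nat) (f : R -> C) : R -> C :=
  match n with O => f | S n => Dn n (D f) end.

Fixpoint smooth_to (n : nat) (f : R -> C) : Prop :=
  match n with
  | O => True
  | S n => (forall t, has_deriv f t (D f t)) /\ smooth_to n (D f)
  end.

Definition smooth (f : R -> C) : Prop :=
  (forall t, f (t + 2 * PI) = f t) /\ forall n, smooth_to n f.

Definition bounded_to (k : nat) (M : R) (f : R -> C) : Prop :=
  forall j t, (j <= k)%nat -> Cmod (Dn j f t) <= M.

Lemma Cmod_le_abs (z : C) : Cmod z <= Rabs (fst z) + Rabs (snd z).
Proof.
  destruct z as [x y]; simpl.
  replace (x, y) with (Cplus (RtoC x) (Cmult Ci (RtoC y)))
    by (unfold Cplus, Cmult, Ci, RtoC; simpl; f_equal; ring).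
  eapply Rle_trans; [apply Cmod_triangle|].
  rewrite Cmod_mult, Cmod_Ci, !Cmod_R; lra.
Qed.

Lemma abs_fst_le (z : C) : Rabs (fst z) <= Cmod z.
Proof. apply re_le_Cmod. Qed.

Lemma abs_snd_le (z : C) : Rabs (snd z) <= Cmod z.
Proof. eapply Rle_trans; [apply Rmax_r|apply Rmax_Cmod]. Qed.

Lemma Cmod_minus_sym (z w : C) : Cmod (z - w) = Cmod (w - z).
Proof. replace (w - z)%C with (- (z - w))%C by ring. now rewrite Cmod_opp. Qed.

Lemma Cmod_triangle_minus (z w : C) : Cmod (z - w) <= Cmod z + Cmod w.
Proof. unfold Cminus. rewrite <- (Cmod_opp w). apply Cmod_triangle. Qed.

Lemma Cmod_triangle_mid (x y z : C) : Cmod (x - z) <= Cmod (x - y) + Cmod (y - z).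
Proof. replace (x - z)%C with ((x - y) + (y - z))%C by ring. apply Cmod_triangle. Qed.

Lemma has_deriv_D f t l : has_deriv f t l -> D f t = l.
Proof.
  intros [H1 H2]. apply injective_projections; simpl; now apply is_derive_unique.
Qed.

Lemma D_unique f f' : (forall t, has_deriv f t (f' t)) -> D f = f'.
Proof. intros H. apply functional_extensionality; intros t. now apply has_deriv_D. Qed.

Lemma smooth_to_intro n f f' :
  (forall t, has_deriv f t (f' t)) -> smooth_to n f' -> smooth_to (S n) f.
Proof. intros H H'. simpl. rewrite (D_unique _ _ H). now split. Qed.

Lemma smooth_to_pred n f : smooth_to (S n) f -> smooth_to n f.
Proof.
  revert f; induction n as [|n IH]; intros f H; [exact I|].
  destruct H as [H1 H2]. split; [exact H1|now apply IH].
Qed.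

Lemma has_deriv_const c t : has_deriv (fun _ => c) t (RtoC 0).
Proof. split; simpl; apply (is_derive_const (K := R_AbsRing) (V := R_NormedModule)). Qed.

Lemma has_deriv_plus f g t a b :
  has_deriv f t a -> has_deriv g t b -> has_deriv (fun x => (f x + g x)%C) t (a + b)%C.
Proof. intros [? ?] [? ?]; split; simpl; now apply @is_derive_plus. Qed.

Lemma has_deriv_mult f g t a b :
  has_deriv f t a -> has_deriv g t b ->
  has_deriv (fun x => (f x * g x)%C) t (a * g t + f t * b)%C.
Proof.
  intros [F1 F2] [G1 G2]; split; simpl.
  - replace (fst a * fst (g t) - snd a * snd (g t) + (fst (f t) * fst b - snd (f t) * snd b))
      with (minus (fst a * fst (g t) + fst (f t) * fst b) (snd a * snd (g t) + snd (f t) * snd b))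
      by (unfold minus, plus, opp; simpl; ring).
    apply @is_derive_minus; apply (is_derive_mult (K := R_AbsRing)); auto; apply Rmult_comm.
  - replace (fst a * snd (g t) + snd a * fst (g t) + (fst (f t) * snd b + snd (f t) * fst b))
      with (plus (fst a * snd (g t) + fst (f t) * snd b) (snd a * fst (g t) + snd (f t) * fst b))
      by (unfold plus; simpl; ring).
    apply @is_derive_plus; apply (is_derive_mult (K := R_AbsRing)); auto; apply Rmult_comm.
Qed.

Lemma has_deriv_affine f t (c v : R) l :
  has_deriv f (c * t + v) l -> has_deriv (fun x => f (c * x + v)) t (RtoC c * l)%C.
Proof.
  assert (A : is_derive (fun x => c * x + v) t c) by (auto_derive; [exact I|ring]).
  intros [F1 F2]; split; simpl.
  - replace (c * fst l - 0 * snd l) with (scal c (fst l)) by (unfold scal; simpl; unfold mult; simpl; ring).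
    apply (is_derive_comp (fun y => fst (f y))); auto.
  - replace (c * snd l + 0 * fst l) with (scal c (snd l)) by (unfold scal; simpl; unfold mult; simpl; ring).
    apply (is_derive_comp (fun y => snd (f y))); auto.
Qed.

Lemma has_deriv_real (f : R -> R) t l : is_derive f t l -> has_deriv (fun x => RtoC (f x)) t (RtoC l).
Proof. intros H; split; simpl; [exact H|apply (is_derive_const (K := R_AbsRing) (V := R_NormedModule))]. Qed.

Lemma has_deriv_eq f t l l' : has_deriv f t l -> l = l' -> has_deriv f t l'.
Proof. now intros H <-. Qed.

Lemma smooth_to_const n c : smooth_to n (fun _ => c).
Proof.
  revert c; induction n as [|n IH]; intros c; [exact I|].
  apply smooth_to_intro with (f' := fun _ => RtoC 0); [|apply IH].
  intros; apply has_deriv_const.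
Qed.

Lemma smooth_to_plus n f g : smooth_to n f -> smooth_to n g -> smooth_to n (fun t => (f t + g t)%C).
Proof.
  revert f g; induction n as [|n IH]; intros f g F G; [exact I|].
  destruct F as [F1 F2], G as [G1 G2].
  apply smooth_to_intro with (f' := fun t => (D f t + D g t)%C); [|now apply IH].
  intros; now apply has_deriv_plus.
Qed.

Lemma smooth_to_mult n f g : smooth_to n f -> smooth_to n g -> smooth_to n (fun t => (f t * g t)%C).
Proof.
  revert f g; induction n as [|n IH]; intros f g F G; [exact I|].
  pose proof (smooth_to_pred _ _ F) as F0; pose proof (smooth_to_pred _ _ G) as G0.
  destruct F as [F1 F2], G as [G1 G2].
  apply smooth_to_intro with (f' := fun t => (D f t * g t + f t * D g t)%C).
  - intros; now apply has_deriv_mult.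
  - apply smooth_to_plus; now apply IH.
Qed.

Lemma smooth_to_affine n f c v : smooth_to n f -> smooth_to n (fun t => f (c * t + v)).
Proof.
  revert f; induction n as [|n IH]; intros f F; [exact I|].
  destruct F as [F1 F2].
  apply smooth_to_intro with (f' := fun t => (RtoC c * D f (c * t + v))%C).
  - intros; now apply has_deriv_affine.
  - apply (smooth_to_mult n (fun _ => RtoC c) (fun t => D f (c * t + v)));
      [apply smooth_to_const|now apply IH].
Qed.

Lemma smooth_has_deriv f t : smooth f -> has_deriv f t (D f t).
Proof. intros [_ H]. apply (proj1 (H 1%nat)). Qed.

Lemma smooth_const c : smooth (fun _ => c).
Proof. split; [reflexivity|intros; apply smooth_to_const]. Qed.

Lemma smooth_plus f g : smooth f -> smooth g -> smooth (fun t => (f t + g t)%C).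
Proof.
  intros [F1 F2] [G1 G2]; split; [intros; now rewrite F1, G1|intros; now apply smooth_to_plus].
Qed.

Lemma smooth_mult f g : smooth f -> smooth g -> smooth (fun t => (f t * g t)%C).
Proof.
  intros [F1 F2] [G1 G2]; split; [intros; now rewrite F1, G1|intros; now apply smooth_to_mult].
Qed.

Lemma smooth_scal c f : smooth f -> smooth (fun t => (c * f t)%C).
Proof. intros H. apply (smooth_mult (fun _ => c)); [apply smooth_const|exact H]. Qed.

Lemma smooth_ext f g : (forall t, f t = g t) -> smooth f -> smooth g.
Proof. intros E. now rewrite (functional_extensionality _ _ E). Qed.

Lemma smooth_minus f g : smooth f -> smooth g -> smooth (fun t => (f t - g t)%C).
Proof.
  intros F G. apply smooth_ext with (fun t => (f t + (- (1)) * g t)%C); [intros; ring|].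
  apply smooth_plus; [exact F|now apply smooth_scal].
Qed.

Lemma smooth_D f : smooth f -> smooth (D f).
Proof.
  intros Hf; pose proof Hf as [P S]; split; [|intros n; apply (S (Datatypes.S n))].
  intros t. symmetry. apply has_deriv_D.
  apply has_deriv_eq with (RtoC 1 * D f (t + 2 * PI))%C; [|ring].
  replace f with (fun x => f (1 * x + 2 * PI)) at 1
    by (apply functional_extensionality; intros x; rewrite Rmult_1_l; apply P).
  apply has_deriv_affine. rewrite Rmult_1_l. now apply smooth_has_deriv.
Qed.

Lemma smooth_Dn n f : smooth f -> smooth (Dn n f).
Proof. revert f; induction n; intros f H; [exact H|]. apply IHn. now apply smooth_D. Qed.

Lemma periodic_Z (f : R -> C) : (forall t, f (t + 2 * PI) = f t) ->
  forall (k : Z) t, f (t + 2 * IZR k * PI) = f t.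
Proof.
  intros P.
  assert (N : forall (k : nat) t, f (t + 2 * INR k * PI) = f t).
  { induction k as [|k IH]; intros t; [f_equal; simpl; ring|].
    rewrite S_INR. replace (t + 2 * (INR k + 1) * PI) with ((t + 2 * INR k * PI) + 2 * PI) by ring.
    now rewrite P. }
  intros k t. destruct (Z.le_ge_cases 0 k).
  - rewrite <- (Z2Nat.id k), <- INR_IZR_INZ by assumption. apply N.
  - rewrite <- (N (Z.to_nat (- k)) (t + 2 * IZR k * PI)). f_equal.
    rewrite INR_IZR_INZ, Z2Nat.id, opp_IZR by lia. ring.
Qed.

Lemma smooth_affine f (n : Z) v : smooth f -> smooth (fun t => f (IZR n * t + v)).
Proof.
  intros [P S]; split; [|intros; now apply smooth_to_affine].
  intros t. replace (IZR n * (t + 2 * PI) + v) with ((IZR n * t + v) + 2 * IZR n * PI) by ring.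
  now apply periodic_Z.
Qed.

Lemma Dn_out n f : Dn (S n) f = D (Dn n f).
Proof. revert f; induction n as [|n IH]; intros f; [reflexivity|]. apply (IH (D f)). Qed.

Lemma D_plus f g : smooth f -> smooth g -> D (fun t => (f t + g t)%C) = fun t => (D f t + D g t)%C.
Proof. intros; apply D_unique; intros; apply has_deriv_plus; now apply smooth_has_deriv. Qed.

Lemma D_mult f g : smooth f -> smooth g ->
  D (fun t => (f t * g t)%C) = fun t => (D f t * g t + f t * D g t)%C.
Proof. intros; apply D_unique; intros; apply has_deriv_mult; now apply smooth_has_deriv. Qed.

Lemma D_scal c f : smooth f -> D (fun t => (c * f t)%C) = fun t => (c * D f t)%C.
Proof.
  intros; apply D_unique; intros t.
  apply has_deriv_eq with (RtoC 0 * f t + c * D f t)%C; [|ring].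
  apply (has_deriv_mult (fun _ => c)); [apply has_deriv_const|now apply smooth_has_deriv].
Qed.

Lemma Dn_plus n f g : smooth f -> smooth g ->
  Dn n (fun t => (f t + g t)%C) = fun t => (Dn n f t + Dn n g t)%C.
Proof.
  revert f g; induction n as [|n IH]; intros f g F G; [reflexivity|].
  simpl. rewrite D_plus by assumption. apply IH; now apply smooth_D.
Qed.

Lemma Dn_scal n c f : smooth f -> Dn n (fun t => (c * f t)%C) = fun t => (c * Dn n f t)%C.
Proof.
  revert f; induction n as [|n IH]; intros f F; [reflexivity|].
  simpl. rewrite D_scal by assumption. apply IH; now apply smooth_D.
Qed.

Lemma Dn_minus n f g : smooth f -> smooth g ->
  Dn n (fun t => (f t - g t)%C) = fun t => (Dn n f t - Dn n g t)%C.
Proof.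
  intros F G.
  replace (fun t => (f t - g t)%C) with (fun t => (f t + (- (1)) * g t)%C)
    by (apply functional_extensionality; intros; ring).
  rewrite Dn_plus, Dn_scal; auto using smooth_scal.
  apply functional_extensionality; intros; ring.
Qed.

Lemma smooth_continuous f t : smooth f ->
  continuous (fun x => fst (f x)) t /\ continuous (fun x => snd (f x)) t.
Proof.
  intros H. destruct (smooth_has_deriv f t H) as [H1 H2].
  split; apply @ex_derive_continuous; eexists; eassumption.
Qed.

Lemma period_reduce (t : R) : exists k : Z, 0 <= t + 2 * IZR k * PI <= 2 * PI.
Proof.
  pose proof PI_RGT_0 as HP.
  destruct (archimed (t / (2 * PI))) as [A B]. exists (1 - up (t / (2 * PI)))%Z.
  rewrite minus_IZR. set (u := IZR (up (t / (2 * PI)))) in *.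
  assert (E : t = t / (2 * PI) * (2 * PI)) by (field; lra).
  set (s := t / (2 * PI)) in *. rewrite E. nra.
Qed.

Lemma continuous_bounded (h : R -> R) a b : a <= b -> (forall t, a <= t <= b -> continuous h t) ->
  exists M, forall t, a <= t <= b -> Rabs (h t) <= M.
Proof.
  intros Hab Hc.
  destruct (continuity_ab_maj (fun t => Rabs (h t)) a b Hab) as [m [Hm _]].
  - intros c Hcc. apply continuity_pt_filterlim.
    apply (continuous_comp h Rabs); [now apply Hc|apply continuous_Rabs].
  - now exists (Rabs (h m)).
Qed.

Lemma smooth_bounded f : smooth f -> exists M, 0 <= M /\ forall t, Cmod (f t) <= M.
Proof.
  intros H. pose proof PI_RGT_0.
  destruct (continuous_bounded (fun x => fst (f x)) 0 (2 * PI)) as [M1 H1]; [lra|intros; now apply smooth_continuous|].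
  destruct (continuous_bounded (fun x => snd (f x)) 0 (2 * PI)) as [M2 H2]; [lra|intros; now apply smooth_continuous|].
  assert (B : forall t, Cmod (f t) <= M1 + M2).
  { intros t. destruct (period_reduce t) as [k Hk].
    rewrite <- (periodic_Z f (proj1 H) k t).
    eapply Rle_trans; [apply Cmod_le_abs|]. specialize (H1 _ Hk); specialize (H2 _ Hk). simpl in *; lra. }
  exists (M1 + M2); split; [|exact B].
  eapply Rle_trans; [apply Cmod_ge_0|apply (B 0)].
Qed.

Lemma smooth_bounded_to k f : smooth f -> exists M, 0 <= M /\ bounded_to k M f.
Proof.
  revert f; induction k as [|k IH]; intros f H.
  - destruct (smooth_bounded f H) as [M [M0 HM]]. exists M; split; [exact M0|].
    intros j t Hj. replace j with O by lia. apply HM.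
  - destruct (smooth_bounded f H) as [M [M0 HM]].
    destruct (IH (D f) (smooth_D f H)) as [M' [M0' HM']].
    exists (M + M'); split; [lra|]. intros [|j] t Hj; simpl.
    + specialize (HM t); lra.
    + specialize (HM' j t ltac:(lia)); lra.
Qed.

Lemma bounded_to_D k M f : bounded_to (S k) M f -> bounded_to k M (D f).
Proof. intros H j t Hj. apply (H (S j) t); lia. Qed.

Lemma bounded_to_le k k' M f : (k <= k')%nat -> bounded_to k' M f -> bounded_to k M f.
Proof. intros Hk H j t Hj. apply H; lia. Qed.

Lemma bounded_to_nonneg k M f : bounded_to k M f -> 0 <= M.
Proof. intros H. eapply Rle_trans; [apply Cmod_ge_0|apply (H O 0)]; lia. Qed.

Lemma bounded_to_plus k M N f g : smooth f -> smooth g ->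
  bounded_to k M f -> bounded_to k N g -> bounded_to k (M + N) (fun t => (f t + g t)%C).
Proof.
  intros F G HF HG j t Hj. rewrite Dn_plus by assumption.
  eapply Rle_trans; [apply Cmod_triangle|]. apply Rplus_le_compat; auto.
Qed.

(* The constant is uniform in [f]: multiplication by [g] is continuous for the C^k norm. *)
Lemma bounded_to_mult k g : smooth g -> exists A, 0 <= A /\
  forall f M, smooth f -> bounded_to k M f -> bounded_to k (A * M) (fun t => (g t * f t)%C).
Proof.
  revert g; induction k as [|k IH]; intros g G;
    destruct (smooth_bounded g G) as [B [B0 HB]].
  - exists B; split; [exact B0|]. intros f M F HM j t Hj. replace j with O by lia.
    simpl. rewrite Cmod_mult. apply Rmult_le_compat; auto using Cmod_ge_0. apply (HM O t); lia.
  - destruct (IH g G) as [A1 [A10 H1]]. destruct (IH (D g) (smooth_D g G)) as [A2 [A20 H2]].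
    exists (B + A1 + A2); split; [lra|]. intros f M F HM j t Hj.
    assert (M0 := bounded_to_nonneg _ _ _ HM).
    destruct j as [|j].
    + simpl. rewrite Cmod_mult. apply Rle_trans with (B * M); [|nra].
      apply Rmult_le_compat; auto using Cmod_ge_0. apply (HM O t); lia.
    + simpl. rewrite D_mult by assumption.
      apply Rle_trans with (A2 * M + A1 * M); [|nra].
      refine (bounded_to_plus k _ _ _ _ _ _ _ _ j t _);
        auto using smooth_mult, smooth_D; [| |lia].
      * apply H2; [exact F|]. apply bounded_to_le with (S k); [lia|exact HM].
      * apply H1; [now apply smooth_D|]. now apply bounded_to_D.
Qed.

Lemma bounded_to_affine k c v : exists A, 0 <= A /\
  forall f M, smooth f -> bounded_to k M f -> bounded_to k (A * M) (fun t => f (c * t + v)).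
Proof.
  (* The j-th derivative gains a factor [c ^ j]; the added 1 makes the base at least 1, so that one
     power dominates all [j <= k]. *)
  exists ((1 + Rabs c) ^ k). pose proof (Rabs_pos c) as Hc.
  split; [apply pow_le; lra|]. intros f M F HM j t Hj.
  assert (M0 := bounded_to_nonneg _ _ _ HM).
  assert (E : Dn j (fun t => f (c * t + v)) t = (RtoC (c ^ j) * Dn j f (c * t + v))%C).
  { clear -F. revert t; induction j as [|j IH]; intros t; [simpl; ring|].
    rewrite Dn_out, (functional_extensionality _ _ IH).
    assert (S : smooth (Dn j f)) by now apply smooth_Dn.
    apply has_deriv_D.
    apply has_deriv_eq with (RtoC 0 * Dn j f (c * t + v) + RtoC (c ^ j) * (RtoC c * D (Dn j f) (c * t + v)))%C.
    - apply (has_deriv_mult (fun _ => RtoC (c ^ j)) (fun s => Dn j f (c * s + v)));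
        [apply has_deriv_const|].
      apply has_deriv_affine. now apply smooth_has_deriv.
    - rewrite <- Dn_out. simpl pow. rewrite RtoC_mult. ring. }
  rewrite E, Cmod_mult, Cmod_R. apply Rmult_le_compat; auto using Cmod_ge_0, Rabs_pos.
  rewrite <- RPow_abs. apply Rle_trans with ((1 + Rabs c) ^ j).
  - apply pow_incr; lra.
  - apply Rle_pow; lra || lia.
Qed.

(** * Exponentials *)

Definition e (k : Z) (t : R) : C := eit (IZR k * t).

Lemma eit_plus x y : eit (x + y) = (eit x * eit y)%C.
Proof. unfold eit, Cmult; simpl. rewrite cos_plus, sin_plus. f_equal; ring. Qed.

Lemma eit_0 : eit 0 = RtoC 1.
Proof. unfold eit, RtoC. now rewrite cos_0, sin_0. Qed.

Lemma Cmod_eit x : Cmod (eit x) = 1.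
Proof.
  unfold Cmod, eit; simpl. replace (_ + _) with 1; [apply sqrt_1|].
  pose proof (sin2_cos2 x) as H; unfold Rsqr in H; lra.
Qed.

Lemma e_plus j k t : e (j + k) t = (e j t * e k t)%C.
Proof. unfold e. now rewrite plus_IZR, Rmult_plus_distr_r, eit_plus. Qed.

Lemma e_0 t : e 0 t = RtoC 1.
Proof. unfold e. now rewrite Rmult_0_l, eit_0. Qed.

Lemma Cmod_e k t : Cmod (e k t) = 1.
Proof. apply Cmod_eit. Qed.

Lemma has_deriv_e k t : has_deriv (e k) t (Ci * RtoC (IZR k) * e k t)%C.
Proof.
  unfold e, eit, has_deriv; simpl. split; auto_derive; auto; ring.
Qed.

Lemma eit_period t : eit (t + 2 * PI) = eit t.
Proof. rewrite eit_plus. unfold eit at 2. rewrite cos_2PI, sin_2PI. apply Cmult_1_r. Qed.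

Lemma smooth_e k : smooth (e k).
Proof.
  split.
  - intros t. unfold e.
    replace (IZR k * (t + 2 * PI)) with (IZR k * t + 2 * IZR k * PI) by ring.
    apply periodic_Z, eit_period.
  - induction n as [|n IH]; [exact I|].
    apply smooth_to_intro with (f' := fun t => (Ci * RtoC (IZR k) * e k t)%C).
    + intros; apply has_deriv_e.
    + apply (smooth_to_mult n (fun _ => (Ci * RtoC (IZR k))%C)); [apply smooth_to_const|exact IH].
Qed.

Lemma e_affine k (n : Z) v t : e k (IZR n * t + v) = (eit (IZR k * v) * e (n * k) t)%C.
Proof.
  unfold e. rewrite mult_IZR, <- eit_plus. f_equal; ring.
Qed.

(** * The Dirichlet kernel *)

Lemma RInt_minus_R (f g : R -> R) a b : ex_RInt f a b -> ex_RInt g a b ->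
  RInt (fun t => f t - g t) a b = RInt f a b - RInt g a b.
Proof. exact (RInt_minus (V := R_CompleteNormedModule) f g a b). Qed.

Lemma RInt_plus_R (f g : R -> R) a b : ex_RInt f a b -> ex_RInt g a b ->
  RInt (fun t => f t + g t) a b = RInt f a b + RInt g a b.
Proof. exact (RInt_plus (V := R_CompleteNormedModule) f g a b). Qed.

Lemma RInt_scal_R (f : R -> R) a b l : ex_RInt f a b ->
  RInt (fun t => l * f t) a b = l * RInt f a b.
Proof. exact (RInt_scal (V := R_CompleteNormedModule) f a b l). Qed.

(** Integration by parts gains the factor [1 / l]; [A] collects the two boundary terms and the
    integral of [w'], none of which depends on [l]. *)
Lemma riemann_lebesgue (w w' : R -> R) a b : a <= b ->
  (forall t, a <= t <= b -> is_derive w t (w' t)) ->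
  (forall t, a <= t <= b -> continuous w' t) ->
  exists A, 0 <= A /\ forall l, 0 < l -> Rabs (RInt (fun t => w t * sin (l * t)) a b) <= A / l.
Proof.
  intros Hab Hd Hc.
  assert (Hw : forall t, a <= t <= b -> continuous w t).
  { intros t Ht. apply @ex_derive_continuous. eexists; now apply Hd. }
  destruct (continuous_bounded w a b Hab Hw) as [B HB].
  destruct (continuous_bounded w' a b Hab Hc) as [B' HB'].
  assert (Bp : 0 <= B) by (eapply Rle_trans; [apply Rabs_pos|apply (HB a); lra]).
  assert (Bp' : 0 <= B') by (eapply Rle_trans; [apply Rabs_pos|apply (HB' a); lra]).
  exists (2 * B + (b - a) * B'). split; [nra|]. intros l Hl.
  assert (cc : forall t, continuous (fun t => cos (l * t)) t).
  { intros t. apply @ex_derive_continuous. auto_derive; auto. }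
  assert (cs : forall t, continuous (fun t => sin (l * t)) t).
  { intros t. apply @ex_derive_continuous. auto_derive; auto. }
  set (W := fun t => - (w t * cos (l * t))).
  assert (E : is_RInt (fun t => l * (w t * sin (l * t)) - w' t * cos (l * t)) a b (W b - W a)).
  { apply (is_RInt_derive (V := R_CompleteNormedModule) W).
    - intros t Ht. rewrite Rmin_left, Rmax_right in Ht by lra. unfold W.
      evar_last. { apply @is_derive_opp. apply (is_derive_mult (K := R_AbsRing)).
        + now apply Hd. + apply (is_derive_comp cos (fun t => l * t)). apply is_derive_cos.
          apply (is_derive_scal (fun t => t)). apply @is_derive_id. + apply Rmult_comm. }
      unfold minus, plus, opp, scal, one, mult; simpl; unfold mult; simpl. ring.
    - intros t Ht. rewrite Rmin_left, Rmax_right in Ht by lra.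
      apply (continuous_minus (V := R_NormedModule)); [apply (continuous_scal_r (K:=R_AbsRing) (V:=R_NormedModule) l)|];
       apply (continuous_mult (K:=R_AbsRing)); auto. }
  assert (I1 : ex_RInt (fun t => w t * sin (l * t)) a b).
  { apply (ex_RInt_continuous (V := R_CompleteNormedModule)). intros t Ht.
    rewrite Rmin_left, Rmax_right in Ht by lra. apply (continuous_mult (K:=R_AbsRing)); auto. }
  assert (I2 : ex_RInt (fun t => w' t * cos (l * t)) a b).
  { apply (ex_RInt_continuous (V := R_CompleteNormedModule)). intros t Ht.
    rewrite Rmin_left, Rmax_right in Ht by lra. apply (continuous_mult (K:=R_AbsRing)); auto. }
  apply (is_RInt_unique (V := R_CompleteNormedModule)) in E.
  rewrite RInt_minus_R, RInt_scal_R in E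
    by (try exact I2; try exact I1; apply (ex_RInt_scal (V := R_NormedModule)); exact I1).
  assert (J : Rabs (RInt (fun t => w' t * cos (l * t)) a b) <= (b - a) * B').
  { apply abs_RInt_le_const; auto. intros t Ht. rewrite Rabs_mult.
    pose proof (COS_bound (l * t)). specialize (HB' t Ht).
    assert (Rabs (cos (l * t)) <= 1) by (apply Rabs_le; lra).
    pose proof (Rabs_pos (w' t)); pose proof (Rabs_pos (cos (l*t))); nra. }
  assert (WB : forall t, a <= t <= b -> Rabs (W t) <= B).
  { intros t Ht. unfold W. rewrite Rabs_Ropp, Rabs_mult.
    pose proof (COS_bound (l * t)). specialize (HB t Ht).
    assert (Rabs (cos (l * t)) <= 1) by (apply Rabs_le; lra).
    pose proof (Rabs_pos (w t)); pose proof (Rabs_pos (cos (l*t))); nra. }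
  apply Rmult_le_reg_l with l; [lra|]. replace (l * ((2 * B + (b - a) * B') / l)) with (2 * B + (b - a) * B') by (field; lra).
  rewrite <- (Rabs_pos_eq l) at 1 by lra. rewrite <- Rabs_mult.
  pose proof (WB a ltac:(lra)) as Wa; pose proof (WB b ltac:(lra)) as Wb.
  apply Rabs_le_between in Wa. apply Rabs_le_between in Wb. apply Rabs_le_between in J.
  apply Rabs_le_between. lra.
Qed.

Fixpoint dirichlet (N : nat) (t : R) : R :=
  match N with O => 1 | S n => dirichlet n t + 2 * cos (INR (S n) * t) end.

(** The product form of the closed formula for the kernel holds also at the zeros of [sin (t / 2)];
    the induction telescopes by the addition formulas. *)
Lemma dirichlet_sin N t : dirichlet N t * sin (t / 2) = sin ((INR N + / 2) * t).
Proof.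
  induction N as [|N IH].
  - simpl. rewrite Rmult_1_l. apply (f_equal sin); lra.
  - change (dirichlet (S N) t) with (dirichlet N t + 2 * cos (INR (S N) * t)).
    rewrite Rmult_plus_distr_r, IH.
    replace ((INR N + / 2) * t) with (INR (S N) * t - t / 2) by (rewrite S_INR; field).
    replace ((INR (S N) + / 2) * t) with (INR (S N) * t + t / 2) by field.
    rewrite sin_plus, sin_minus. ring.
Qed.

Lemma dirichlet_continuous N t : continuous (dirichlet N) t.
Proof.
  induction N as [|N IH]; [apply continuous_const|].
  apply (continuous_plus (V := R_NormedModule) (dirichlet N) (fun t => 2 * cos (INR (S N) * t))); [exact IH|].
  apply @ex_derive_continuous. auto_derive; auto.
Qed.

Lemma RInt_dirichlet N : is_RInt (dirichlet N) (- PI) PI (2 * PI).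
Proof.
  induction N as [|N IH].
  - evar_last. { apply (is_RInt_const (V := R_NormedModule)). }
    unfold scal; simpl; unfold mult; simpl; ring.
  - change (dirichlet (S N)) with (fun t => dirichlet N t + 2 * cos (INR (S N) * t)).
    assert (Hl : INR (S N) <> 0) by (apply not_0_INR; lia).
    assert (Z : sin (INR (S N) * PI) = 0) by (rewrite INR_IZR_INZ; apply sin_eq_0_1; now eexists).
    revert Hl Z; generalize (INR (S N)); intros l Hl Z.
    evar_last.
    { apply (is_RInt_plus (V := R_NormedModule) (dirichlet N) (fun t => 2 * cos (l * t))); [exact IH|].
      apply (is_RInt_derive (V := R_CompleteNormedModule) (fun t => 2 * sin (l * t) / l)).
      - intros t _. auto_derive; [auto|]. now field.
      - intros t _. apply @ex_derive_continuous. auto_derive; auto. }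
    unfold minus, plus, opp; simpl.
    replace (l * - PI) with (- (l * PI)) by ring. rewrite sin_neg, Z. now field.
Qed.

Lemma sin_ge_half x : 0 <= x <= 1 -> x / 2 <= sin x.
Proof.
  intros Hx. destruct (Req_dec x 0) as [->|Hx0]; [rewrite sin_0; lra|].
  destruct (MVT_cor2 sin cos 0 x) as [c [Hc1 Hc2]]; [lra|intros; apply derivable_pt_lim_sin|].
  rewrite sin_0 in Hc1.
  assert (/ 2 <= cos c).
  { pose proof PI_4 as P4. assert (3 < PI) by (pose proof PI2_3_2; unfold PI2 in *; lra).
    replace (/2) with (cos (PI / 3)) by (rewrite cos_PI3; lra).
    apply cos_decr_1; lra. }
  nra.
Qed.

Lemma sin_half_ge t : Rabs t <= 1 -> Rabs t / 4 <= Rabs (sin (t / 2)).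
Proof.
  intros Ht. unfold Rabs in Ht |- * at 1; destruct (Rcase_abs t) as [H|H].
  - rewrite <- Rabs_Ropp, <- sin_neg. replace (- (t / 2)) with ((- t) / 2) by field.
    pose proof (sin_ge_half (- t / 2) ltac:(lra)). rewrite Rabs_pos_eq; lra.
  - pose proof (sin_ge_half (t / 2) ltac:(lra)). rewrite Rabs_pos_eq; lra.
Qed.

Lemma ex_RInt_cont (f : R -> R) a b : (forall t, continuous f t) -> ex_RInt f a b.
Proof. intros H. apply (ex_RInt_continuous (V := R_CompleteNormedModule)). auto. Qed.

(* On a region where [sin (t/2)] does not vanish, [h * dirichlet N] is [w t * sin ((N+1/2) t)] with [w] of class C^1. *)
Lemma dirichlet_off_zero (h h' : R -> R) a b : a <= b ->
  (forall t, is_derive h t (h' t)) -> (forall t, continuous h' t) ->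
  (forall t, a <= t <= b -> sin (t / 2) <> 0) ->
  exists A, 0 <= A /\ forall N, Rabs (RInt (fun t => h t * dirichlet N t) a b) <= A / (INR N + / 2).
Proof.
  intros Hab Hd Hc Hs.
  destruct (riemann_lebesgue (fun t => h t / sin (t / 2))
     (fun t => (h' t * sin (t / 2) - h t * (cos (t / 2) / 2)) / (sin (t / 2)) ^ 2) a b Hab) as [A [A0 HA]].
  - intros t Ht. specialize (Hs t Ht).
    evar_last. { apply (is_derive_div h (fun t => sin (t / 2)) t (h' t) (cos (t / 2) / 2)); auto. auto_derive; [auto|unfold Rdiv; ring]. }
    reflexivity.
  - intros t Ht. specialize (Hs t Ht).
    assert (c1 : continuous (fun t => sin (t / 2)) t) by (apply @ex_derive_continuous; auto_derive; auto).
    assert (c2 : continuous (fun t => cos (t / 2) / 2) t) by (apply @ex_derive_continuous; auto_derive; auto).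
    assert (c3 : continuous (fun t => / (sin (t / 2)) ^ 2) t).
    { apply @ex_derive_continuous; auto_derive. apply Rmult_integral_contrapositive_currified; [exact Hs|].
      rewrite Rmult_1_r; exact Hs. }
    apply (continuous_mult (K := R_AbsRing) (fun t => h' t * sin (t / 2) - h t * (cos (t / 2) / 2)) (fun t => / (sin (t / 2)) ^ 2)); auto.
    apply (continuous_minus (V := R_NormedModule)); apply (continuous_mult (K := R_AbsRing)); auto.
    apply @ex_derive_continuous. eexists; apply Hd.
  - exists A; split; [exact A0|]. intros N.
    pose proof (pos_INR N).
    rewrite (RInt_ext _ (fun t => h t / sin (t / 2) * sin ((INR N + / 2) * t))); [apply HA; lra|].
    intros t Ht. rewrite Rmin_left, Rmax_right in Ht by lra.
    change (h t * dirichlet N t = h t / sin (t / 2) * sin ((INR N + / 2) * t)).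
    rewrite <- dirichlet_sin. field. apply Hs; lra.
Qed.

(** Near 0 the function [h] is O(|t|), which cancels the singularity of [1 / sin (t / 2)]: the
    integrand is at most [4 * M] there, uniformly in [N], so a short window costs little. On the two
    remaining intervals the Riemann-Lebesgue bound gives O(1/N). *)
Lemma dirichlet_limit_0 (h h' : R -> R) : h 0 = 0 ->
  (forall t, is_derive h t (h' t)) -> (forall t, continuous h' t) ->
  forall eps, 0 < eps -> exists N0 : nat, forall N, (N0 <= N)%nat ->
    Rabs (RInt (fun t => h t * dirichlet N t) (- PI) PI) <= eps.
Proof.
  intros H0 Hd Hc eps Heps. pose proof PI_RGT_0 as HP.
  assert (PI3 : 3 < PI) by (pose proof PI2_3_2; unfold PI2 in *; lra).
  destruct (continuous_bounded h' (-1) 1) as [M HM]; [lra|auto|].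
  assert (M0 : 0 <= M) by (eapply Rle_trans; [apply Rabs_pos|apply (HM 0); lra]).
  assert (hc : forall t, continuous h t) by (intros; apply @ex_derive_continuous; eexists; apply Hd).
  assert (Lip : forall t, Rabs t <= 1 -> Rabs (h t) <= M * Rabs t).
  { intros t Ht. apply Rabs_le_between in Ht.
    destruct (MVT_gen h 0 t h') as [c [Hc1 Hc2]].
    - intros; apply Hd.
    - intros; apply continuity_pt_filterlim; apply hc.
    - rewrite H0, !Rminus_0_r in Hc2. rewrite Hc2, Rabs_mult. apply Rmult_le_compat_r; [apply Rabs_pos|].
      apply HM. unfold Rmin, Rmax in Hc1. destruct (Rle_dec 0 t); lra. }
  (* The window has length [2 * d] and contributes at most [8 * M * d <= eps / 2]; [M + 1] avoids
     division by 0, and [d <= 1] is the range of the Lipschitz and sine bounds. *)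
  set (d := Rmin 1 (eps / (16 * (M + 1)))).
  assert (d0 : 0 < d) by (apply Rmin_glb_lt; [lra|apply Rdiv_lt_0_compat; lra]).
  assert (d1 : d <= 1) by apply Rmin_l.
  assert (d2 : 8 * M * d <= eps / 2).
  { assert (d <= eps / (16 * (M + 1))) by apply Rmin_r.
    assert (d * (16 * (M + 1)) <= eps).
    { replace eps with (eps / (16 * (M + 1)) * (16 * (M + 1))) by (field; lra). apply Rmult_le_compat_r; lra. }
    nra. }
  destruct (dirichlet_off_zero h h' d PI) as [A1 [A10 HA1]]; auto; [lra| |].
  { intros t Ht. apply Rgt_not_eq, sin_gt_0; lra. }
  destruct (dirichlet_off_zero h h' (- PI) (- d)) as [A2 [A20 HA2]]; auto; [lra| |].
  { intros t Ht. apply Rlt_not_eq. replace (t / 2) with (- ((- t) / 2)) by field. rewrite sin_neg.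
    assert (0 < sin (- t / 2)) by (apply sin_gt_0; lra). lra. }
  destruct (nfloor_ex (2 * (A1 + A2) / eps)) as [N0 HN0].
  { apply Rdiv_le_0_compat; lra. }
  exists (S N0). intros N HN.
  assert (HNr : 2 * (A1 + A2) / eps <= INR N).
  { apply le_INR in HN. rewrite S_INR in HN. lra. }
  assert (HN2 : A1 / (INR N + / 2) + A2 / (INR N + / 2) <= eps / 2).
  { pose proof (pos_INR N). replace (A1 / (INR N + / 2) + A2 / (INR N + / 2)) with ((A1 + A2) / (INR N + / 2)) by (field; lra).
    apply Rle_div_l; [lra|]. apply (Rmult_le_compat_r eps) in HNr; [|lra].
    replace (2 * (A1 + A2) / eps * eps) with (2 * (A1 + A2)) in HNr by (field; lra). nra. }
  set (F := fun t => h t * dirichlet N t).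
  assert (Fc : forall t, continuous F t).
  { intros t. apply (continuous_mult (K := R_AbsRing)); [apply hc|apply dirichlet_continuous]. }
  assert (mid : Rabs (RInt F (- d) d) <= (d - - d) * (4 * M)).
  { apply abs_RInt_le_const; [lra|now apply ex_RInt_cont|]. intros t Ht. unfold F.
    assert (T1 : Rabs t <= 1) by (apply Rabs_le; lra).
    destruct (Req_dec t 0) as [->|Tn]; [rewrite H0, Rmult_0_l, Rabs_R0; lra|].
    pose proof (Rabs_pos_lt t Tn) as Tp.
    pose proof (sin_half_ge t T1) as Hs. pose proof (Lip t T1) as Hl.
    apply Rmult_le_reg_r with (Rabs (sin (t / 2))); [lra|].
    rewrite <- Rabs_mult, Rmult_assoc, dirichlet_sin, Rabs_mult.
    assert (Rabs (sin ((INR N + / 2) * t)) <= 1) by (apply Rabs_le, SIN_bound).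
    pose proof (Rabs_pos (h t)); pose proof (Rabs_pos (sin ((INR N + / 2) * t))). nra. }
  specialize (HA1 N); specialize (HA2 N). fold F in HA1, HA2.
  rewrite <- (RInt_Chasles F (- PI) (- d) PI), <- (RInt_Chasles F (- d) d PI) by now apply ex_RInt_cont.
  unfold plus; simpl.
  eapply Rle_trans; [apply Rabs_triang|].
  eapply Rle_trans; [apply Rplus_le_compat_l, Rabs_triang|]. lra.
Qed.

(** The kernel integrates to exactly [2 * PI], so the constant [h 0] can be subtracted. *)
Lemma dirichlet_limit (h h' : R -> R) :
  (forall t, is_derive h t (h' t)) -> (forall t, continuous h' t) ->
  is_lim_seq (fun N => RInt (fun t => h t * dirichlet N t) (- PI) PI / (2 * PI)) (h 0).
Proof.
  intros Hd Hc. apply is_lim_seq_spec. intros eps. simpl. pose proof PI_RGT_0 as HP.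
  destruct (dirichlet_limit_0 (fun t => h t - h 0) h') with (eps := PI * eps) as [N0 HN0]; auto.
  - ring.
  - intros t. evar_last. { apply (is_derive_minus h (fun _ => h 0)); [apply Hd|apply (is_derive_const (K:=R_AbsRing) (V:=R_NormedModule))]. }
    unfold minus, plus, opp, zero; simpl; ring.
  - pose proof (cond_pos eps); nra.
  - exists N0. intros N HN. specialize (HN0 N HN).
    assert (hc : forall t, continuous h t) by (intros; apply @ex_derive_continuous; eexists; apply Hd).
    rewrite (RInt_ext _ (fun t => h t * dirichlet N t - h 0 * dirichlet N t)) in HN0
      by (intros; apply Rmult_minus_distr_r).
    rewrite RInt_minus_R in HN0.
    2: { apply ex_RInt_cont. intros; apply (continuous_mult (K:=R_AbsRing)); auto using dirichlet_continuous. }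
    2: { apply (ex_RInt_scal (V := R_NormedModule)). eexists; apply RInt_dirichlet. }
    rewrite RInt_scal_R in HN0 by (eexists; apply RInt_dirichlet).
    rewrite (is_RInt_unique _ _ _ _ (RInt_dirichlet N)) in HN0.
    set (I := RInt (fun t => h t * dirichlet N t) (- PI) PI) in *.
    replace (I / (2 * PI) - h 0) with ((I - h 0 * (2 * PI)) / (2 * PI)) by (field; lra).
    unfold Rdiv. rewrite Rabs_mult, (Rabs_pos_eq (/ (2 * PI))) by (left; apply Rinv_0_lt_compat; lra).
    apply Rlt_div_l; [lra|]. pose proof (cond_pos eps). nra.
Qed.

(** * Fourier series of smooth functions *)

Definition avg (f : R -> C) : C :=
  (RInt (fun t => fst (f t)) (- PI) PI / (2 * PI), RInt (fun t => snd (f t)) (- PI) PI / (2 * PI)).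

Lemma smooth_ex_RInt f a b : smooth f ->
  ex_RInt (fun t => fst (f t)) a b /\ ex_RInt (fun t => snd (f t)) a b.
Proof. intros H; split; apply ex_RInt_cont; intros; now apply smooth_continuous. Qed.

Lemma avg_plus f g : smooth f -> smooth g -> avg (fun t => (f t + g t)%C) = (avg f + avg g)%C.
Proof.
  intros F G. pose proof PI_RGT_0.
  destruct (smooth_ex_RInt f (- PI) PI F), (smooth_ex_RInt g (- PI) PI G).
  apply injective_projections; simpl; rewrite RInt_plus_R by assumption; field; lra.
Qed.

Lemma avg_scal c f : smooth f -> avg (fun t => (c * f t)%C) = (c * avg f)%C.
Proof.
  intros F. pose proof PI_RGT_0.
  destruct (smooth_ex_RInt f (- PI) PI F) as [F1 F2].
  apply injective_projections; simpl.
  - rewrite RInt_minus_R, !RInt_scal_R by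
      (assumption || (apply (ex_RInt_scal (V := R_NormedModule)); assumption)). field; lra.
  - rewrite RInt_plus_R, !RInt_scal_R by
      (assumption || (apply (ex_RInt_scal (V := R_NormedModule)); assumption)). field; lra.
Qed.

Lemma avg_ext f g : (forall t, f t = g t) -> avg f = avg g.
Proof. intros H. now rewrite (functional_extensionality _ _ H). Qed.

(** The factor 2 comes from bounding real and imaginary parts separately; this crude constant is
    carried into the bounds below. *)
Lemma avg_bound f M : smooth f -> (forall t, Cmod (f t) <= M) -> Cmod (avg f) <= 2 * M.
Proof.
  intros F HM. pose proof PI_RGT_0 as HP.
  destruct (smooth_ex_RInt f (- PI) PI F) as [F1 F2].
  assert (B : forall h, ex_RInt h (- PI) PI -> (forall t, Rabs (h t) <= M) ->
                Rabs (RInt h (- PI) PI / (2 * PI)) <= M).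
  { intros h Hh HhM. unfold Rdiv. rewrite Rabs_mult, (Rabs_pos_eq (/ _)) by (left; apply Rinv_0_lt_compat; lra).
    apply Rle_div_l; [lra|]. apply Rle_trans with ((PI - - PI) * M); [|lra].
    apply abs_RInt_le_const; auto; lra. }
  eapply Rle_trans; [apply Cmod_le_abs|]. unfold avg; simpl fst; simpl snd.
  pose proof (B _ F1 (fun t => Rle_trans _ _ _ (abs_fst_le _) (HM t))).
  pose proof (B _ F2 (fun t => Rle_trans _ _ _ (abs_snd_le _) (HM t))). lra.
Qed.

Lemma RInt_D (h h' : R -> R) : (forall t, is_derive h t (h' t)) -> (forall t, continuous h' t) ->
  h (- PI) = h PI -> RInt h' (- PI) PI = 0.
Proof.
  intros Hd Hc E. apply is_RInt_unique. evar_last.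
  { apply (is_RInt_derive (V := R_CompleteNormedModule) h); auto. }
  unfold minus, plus, opp; simpl. rewrite E. apply Rplus_opp_r.
Qed.

Lemma avg_D f : smooth f -> avg (D f) = RtoC 0.
Proof.
  intros F. assert (P : f (- PI) = f PI).
  { rewrite <- (proj1 F (- PI)). f_equal; ring. }
  unfold avg. pose proof PI_RGT_0.
  rewrite (RInt_D (fun t => fst (f t)) (fun t => fst (D f t))), (RInt_D (fun t => snd (f t)) (fun t => snd (D f t))).
  - apply injective_projections; simpl; field; lra.
  - intros; now apply smooth_has_deriv.
  - intros; now apply smooth_continuous, smooth_D.
  - now rewrite P.
  - intros; now apply smooth_has_deriv.
  - intros; now apply smooth_continuous, smooth_D.
  - now rewrite P.
Qed.

Lemma RInt_translate (h : R -> R) a b x : (forall t, continuous h t) ->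
  RInt (fun t => h (t + x)) a b = RInt h (a + x) (b + x).
Proof.
  intros Hc. pose proof (RInt_comp_lin (V := R_CompleteNormedModule) h 1 x a b) as E.
  rewrite !Rmult_1_l in E. rewrite <- E by now apply ex_RInt_cont.
  apply RInt_ext. intros t _. change (h (t + x) = 1 * h (1 * t + x)). now rewrite !Rmult_1_l.
Qed.

(** By Chasles, the pieces gained and lost at the two ends are translates of each other by one
    period. *)
Lemma RInt_period_shift (h : R -> R) x : (forall t, continuous h t) -> (forall t, h (t + 2 * PI) = h t) ->
  RInt (fun t => h (t + x)) (- PI) PI = RInt h (- PI) PI.
Proof.
  intros Hc P. rewrite RInt_translate by exact Hc.
  assert (I : forall a b, ex_RInt h a b) by (intros; now apply ex_RInt_cont).
  rewrite <- (RInt_Chasles h (- PI + x) (- PI) (PI + x)), <- (RInt_Chasles h (- PI) PI (PI + x)) by apply I.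
  replace (RInt h PI (PI + x)) with (RInt h (- PI) (- PI + x)).
  - rewrite <- (opp_RInt_swap h (- PI + x) (- PI)) by apply I. unfold plus, opp; simpl. ring.
  - replace PI with (- PI + 2 * PI) at 3 by ring. replace (PI + x) with ((- PI + x) + 2 * PI) by ring.
    rewrite <- RInt_translate by exact Hc. apply RInt_ext. intros; symmetry; apply P.
Qed.

Lemma avg_shift f x : smooth f -> avg (fun t => f (t + x)) = avg f.
Proof.
  intros F. unfold avg.
  rewrite (RInt_period_shift (fun t => fst (f t))), (RInt_period_shift (fun t => snd (f t))); auto;
    solve [intros; now apply smooth_continuous | intros; now rewrite (proj1 F)].
Qed.

Definition fc (f : R -> C) (k : Z) : C := avg (fun t => (f t * e (- k) t)%C).

(** The mean of the derivative of [f * e (- k)] is 0 by periodicity; expanding it by the product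
    rule is the integration by parts. *)
Lemma fc_D f k : smooth f -> fc (D f) k = (Ci * RtoC (IZR k) * fc f k)%C.
Proof.
  intros F.
  assert (E : smooth (e (- k))) by apply smooth_e.
  pose proof (avg_D _ (smooth_mult _ _ F E)) as H.
  rewrite D_mult in H by assumption.
  rewrite (D_unique _ _ (has_deriv_e (- k))) in H.
  rewrite (avg_ext _ (fun t => (D f t * e (- k) t + (- (Ci * RtoC (IZR k))) * (f t * e (- k) t))%C)) in H.
  2: { intros t. rewrite opp_IZR, RtoC_opp. ring. }
  rewrite avg_plus, avg_scal in H; auto using smooth_mult, smooth_D, smooth_scal.
  fold (fc f k) in H. fold (fc (D f) k) in H.
  replace (fc (D f) k) with ((fc (D f) k + - (Ci * RtoC (IZR k)) * fc f k) + Ci * RtoC (IZR k) * fc f k)%C by ring.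
  rewrite H. ring.
Qed.

Lemma fc_bound f k M : smooth f -> (forall t, Cmod (f t) <= M) -> Cmod (fc f k) <= 2 * M.
Proof.
  intros F HM. apply avg_bound; [apply smooth_mult; auto using smooth_e|].
  intros t. now rewrite Cmod_mult, Cmod_e, Rmult_1_r.
Qed.

Lemma fc_decay f k j M : smooth f -> (forall t, Cmod (Dn j f t) <= M) ->
  Rabs (IZR k) ^ j * Cmod (fc f k) <= 2 * M.
Proof.
  intros F HM. replace (Rabs (IZR k) ^ j * Cmod (fc f k)) with (Cmod (fc (Dn j f) k)).
  - apply fc_bound; [now apply smooth_Dn|exact HM].
  - clear HM. induction j as [|j IH]; [simpl; ring|].
    rewrite Dn_out, fc_D by now apply smooth_Dn.
    rewrite !Cmod_mult, Cmod_Ci, Cmod_R, IH. simpl; ring.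
Qed.

Fixpoint ps (a : Z -> C) (N : nat) : C :=
  match N with
  | O => a 0%Z
  | S n => (ps a n + (a (Z.of_nat (S n)) + a (- Z.of_nat (S n))%Z))%C
  end.

Lemma ps_ext a b N : (forall k, a k = b k) -> ps a N = ps b N.
Proof. intros H. now rewrite (functional_extensionality _ _ H). Qed.

Lemma ps_scal c a N : ps (fun k => (c * a k)%C) N = (c * ps a N)%C.
Proof. induction N as [|N IH]; simpl; [reflexivity|]. rewrite IH; ring. Qed.

Lemma smooth_ps (f : Z -> R -> C) N : (forall k, smooth (f k)) -> smooth (fun t => ps (fun k => f k t) N).
Proof.
  intros H. induction N as [|N IH]; simpl; [apply H|].
  apply (smooth_plus (fun t => ps (fun k => f k t) N)); [exact IH|apply smooth_plus; apply H].
Qed.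

(** The comparison [1 / (M + 1)^2 <= 1 / M - 1 / (M + 1)] telescopes; the factor 2 stands for the
    two indices added at each step. *)
Lemma ps_tail a A : (forall k, k <> 0%Z -> Cmod (a k) <= A / (IZR k) ^ 2) ->
  forall N M, (1 <= N <= M)%nat -> Cmod (ps a M - ps a N) <= 2 * A * (/ INR N - / INR M).
Proof.
  intros H N M [HN HM].
  assert (A0 : 0 <= A).
  { specialize (H 1%Z ltac:(discriminate)). pose proof (Cmod_ge_0 (a 1%Z)). simpl in H. lra. }
  induction HM as [|M HM IH].
  - replace (ps a N - ps a N)%C with (RtoC 0) by ring. rewrite Cmod_0. lra.
  - change (ps a (S M)) with (ps a M + (a (Z.of_nat (S M)) + a (- Z.of_nat (S M))%Z))%C.
    replace (ps a M + (a (Z.of_nat (S M)) + a (- Z.of_nat (S M))%Z) - ps a N)%C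
      with ((ps a M - ps a N) + (a (Z.of_nat (S M)) + a (- Z.of_nat (S M))%Z))%C by ring.
    eapply Rle_trans; [apply Cmod_triangle|].
    eapply Rle_trans; [apply Rplus_le_compat; [exact IH|apply Cmod_triangle]|].
    pose proof (H (Z.of_nat (S M)) ltac:(lia)) as H1. pose proof (H (- Z.of_nat (S M))%Z ltac:(lia)) as H2.
    rewrite opp_IZR in H2. rewrite <- INR_IZR_INZ in H1, H2.
    replace ((- INR (S M)) ^ 2) with (INR (S M) ^ 2) in H2 by ring.
    assert (Mp : 0 < INR M) by (apply lt_0_INR; lia).
    rewrite S_INR in *.
    assert (/ (INR M + 1) ^ 2 <= / INR M - / (INR M + 1)).
    { replace (/ INR M - / (INR M + 1)) with (/ (INR M * (INR M + 1))) by (field; lra).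
      apply Rinv_le_contravar; nra. }
    unfold Rdiv in *. nra.
Qed.

(** Here 5 is 3 for the indices -1, 0, 1 plus 2 for the tail beyond them. *)
Lemma ps_bound a A : Cmod (a 0%Z) <= A -> (forall k, k <> 0%Z -> Cmod (a k) <= A / (IZR k) ^ 2) ->
  forall N, Cmod (ps a N) <= 5 * A.
Proof.
  intros H0 H N. pose proof (Cmod_ge_0 (a 0%Z)) as Hp.
  assert (A0 : 0 <= A) by lra.
  destruct N as [|N]; [simpl; lra|].
  pose proof (ps_tail a A H 1 (S N) ltac:(lia)) as T.
  replace (ps a (S N)) with ((ps a (S N) - ps a 1) + ps a 1)%C by ring.
  eapply Rle_trans; [apply Cmod_triangle|].
  assert (B1 : Cmod (ps a 1) <= 3 * A).
  { simpl. eapply Rle_trans; [apply Cmod_triangle|].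
    eapply Rle_trans; [apply Rplus_le_compat_l, Cmod_triangle|].
    pose proof (H 1%Z ltac:(discriminate)) as K1. pose proof (H (-1)%Z ltac:(discriminate)) as K2.
    replace (A / IZR 1 ^ 2) with A in K1 by (simpl; field). replace (A / IZR (-1) ^ 2) with A in K2 by (simpl; field).
    lra. }
  assert (0 < / INR (S N)) by (apply Rinv_0_lt_compat, lt_0_INR; lia).
  simpl INR in T at 1. rewrite Rinv_1 in T. nra.
Qed.

Lemma ps_dirichlet N t : ps (fun k => e k t) N = RtoC (dirichlet N t).
Proof.
  induction N as [|N IH]; [apply e_0|].
  change (ps (fun k => e k t) (S N)) with (ps (fun k => e k t) N + (e (Z.of_nat (S N)) t + e (- Z.of_nat (S N)) t))%C.
  change (dirichlet (S N) t) with (dirichlet N t + 2 * cos (INR (S N) * t)).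
  rewrite IH, RtoC_plus. f_equal. unfold e. rewrite opp_IZR, <- INR_IZR_INZ.
  replace (- INR (S N) * t) with (- (INR (S N) * t)) by ring.
  unfold eit. rewrite cos_neg, sin_neg. apply injective_projections; simpl; ring.
Qed.

Definition trig (f : R -> C) (N : nat) (t : R) : C := ps (fun k => (fc f k * e k t)%C) N.

Lemma smooth_trig f N : smooth (trig f N).
Proof. apply smooth_ps. intros; apply smooth_scal, smooth_e. Qed.

(** Translating by [x] inside the mean turns the k-th term into the mean of [f (t + x)] against
    [e (- k)]; the partial sum is symmetric, so the sign of [k] does not matter and the kernel
    appears. *)
Lemma trig_dirichlet f N x : smooth f ->
  trig f N x = avg (fun t => (RtoC (dirichlet N t) * f (t + x)%R)%C).
Proof.
  intros F.
  assert (Fx : smooth (fun t => f (t + x))).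
  { apply smooth_ext with (fun t => f (IZR 1 * t + x)); [intros; now rewrite Rmult_1_l|now apply smooth_affine]. }
  assert (T : forall k, (fc f k * e k x)%C = avg (fun t => (e (- k) t * f (t + x)%R)%C)).
  { intros k. unfold fc.
    assert (G : smooth (fun t => (f t * e (- k) t)%C)) by (apply smooth_mult; auto using smooth_e).
    rewrite <- (avg_shift _ x G), Cmult_comm, <- avg_scal.
    - apply avg_ext. intros t. unfold e. rewrite opp_IZR.
      replace (- IZR k * t) with (IZR k * x + - IZR k * (t + x)) by ring. rewrite eit_plus. ring.
    - apply smooth_ext with (fun t => (f (IZR 1 * t + x)%R * e (- k) (IZR 1 * t + x))%C);
        [intros; now rewrite Rmult_1_l|].
      apply (smooth_affine (fun t => (f t * e (- k) t)%C)), G. }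
  unfold trig. rewrite (ps_ext _ _ _ T).
  rewrite (avg_ext _ (fun t => (ps (fun k => e k t) N * f (t + x)%R)%C)) by (intros; now rewrite ps_dirichlet).
  assert (S : forall k, smooth (fun t => (e k t * f (t + x)%R)%C)) by (intros; apply smooth_mult; auto using smooth_e).
  induction N as [|N IH]; [reflexivity|].
  cbn [ps]. rewrite IH, <- !avg_plus; auto using smooth_plus.
  - apply avg_ext. intros; rewrite Z.opp_involutive; ring.
  - apply (smooth_mult (fun t => ps (fun k => e k t) N)); [apply smooth_ps, smooth_e|exact Fx].
Qed.

Lemma trig_limit f x : smooth f -> forall eps, 0 < eps ->
  exists N0, forall N, (N0 <= N)%nat -> Cmod (trig f N x - f x) < eps.
Proof.
  intros F eps He.
  assert (Fx : smooth (fun t => f (t + x))).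
  { apply smooth_ext with (fun t => f (IZR 1 * t + x)); [intros; now rewrite Rmult_1_l|now apply smooth_affine]. }
  pose proof (dirichlet_limit (fun t => fst (f (t + x))) (fun t => fst (D (fun t => f (t + x)) t))) as L1.
  pose proof (dirichlet_limit (fun t => snd (f (t + x))) (fun t => snd (D (fun t => f (t + x)) t))) as L2.
  assert (He2 : 0 < eps / 2) by lra.
  apply is_lim_seq_spec in L1; [|intros; now apply smooth_has_deriv|intros; now apply smooth_continuous, smooth_D].
  apply is_lim_seq_spec in L2; [|intros; now apply smooth_has_deriv|intros; now apply smooth_continuous, smooth_D].
  destruct (L1 (mkposreal _ He2)) as [N1 H1]. destruct (L2 (mkposreal _ He2)) as [N2 H2].
  exists (N1 + N2)%nat. intros N HN. specialize (H1 N ltac:(lia)). specialize (H2 N ltac:(lia)).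
  simpl in H1, H2. rewrite Rplus_0_l in H1, H2.
  rewrite trig_dirichlet by exact F.
  eapply Rle_lt_trans; [apply Cmod_le_abs|].
  replace eps with (eps / 2 + eps / 2) by field.
  apply Rplus_lt_compat; unfold avg; simpl fst; simpl snd.
  - rewrite (RInt_ext _ (fun t => fst (f (t + x)) * dirichlet N t)); [exact H1|].
    intros t _. change (dirichlet N t * fst (f (t + x)) - 0 * snd (f (t + x)) = fst (f (t + x)) * dirichlet N t). ring.
  - rewrite (RInt_ext _ (fun t => snd (f (t + x)) * dirichlet N t)); [exact H2|].
    intros t _. change (dirichlet N t * snd (f (t + x)) + 0 * fst (f (t + x)) = snd (f (t + x)) * dirichlet N t). ring.
Qed.

Lemma fc_decay_div f k j M : smooth f -> k <> 0%Z -> (forall t, Cmod (Dn j f t) <= M) ->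
  Cmod (fc f k) <= 2 * M / Rabs (IZR k) ^ j.
Proof.
  intros F Hk HM. pose proof (fc_decay f k j M F HM) as H.
  assert (0 < Rabs (IZR k) ^ j) by (apply pow_lt, Rabs_pos_lt, eq_IZR_contrapositive, Hk).
  apply Rle_div_r; lra.
Qed.

(** Pointwise convergence identifies the limit, and [ps_tail], with coefficients O(k^-2) from the
    second derivative, gives a rate that is uniform in [x]. A violation by a margin [eps] is
    contradicted by one far partial sum. *)
Lemma trig_error f M : smooth f -> (forall t, Cmod (Dn 2 f t) <= M) ->
  forall N, (1 <= N)%nat -> forall x, Cmod (f x - trig f N x) <= 4 * M / INR N.
Proof.
  intros F HM N HN x. apply Rnot_lt_le. intros Hlt.
  assert (M0 : 0 <= M) by (eapply Rle_trans; [apply Cmod_ge_0|apply (HM 0)]).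
  set (eps := Cmod (f x - trig f N x) - 4 * M / INR N).
  destruct (trig_limit f x F eps) as [N0 H0]; [unfold eps; lra|].
  specialize (H0 (N0 + N)%nat ltac:(lia)).
  pose proof (ps_tail (fun k => (fc f k * e k x)%C) (2 * M)) as T.
  specialize (T ltac:(intros k Hk; cbv beta; rewrite Cmod_mult, Cmod_e, Rmult_1_r; rewrite <- pow2_abs; now apply fc_decay_div)).
  specialize (T N (N0 + N)%nat ltac:(lia)). fold (trig f N x) in T. fold (trig f (N0 + N) x) in T.
  pose proof (Cmod_triangle_mid (f x) (trig f (N0 + N) x) (trig f N x)) as Tr.
  rewrite Cmod_minus_sym in H0.
  assert (0 < / INR (N0 + N)) by (apply Rinv_0_lt_compat, lt_0_INR; lia).
  unfold eps in H0. unfold Rdiv in *. nra.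
Qed.

Lemma D_trig f N : smooth f -> D (trig f N) = trig (D f) N.
Proof.
  intros F. apply D_unique. intros t. unfold trig.
  assert (H : forall k, has_deriv (fun s => (fc f k * e k s)%C) t (fc (D f) k * e k t)%C).
  { intros k. apply has_deriv_eq with (RtoC 0 * e k t + fc f k * (Ci * RtoC (IZR k) * e k t))%C.
    - apply (has_deriv_mult (fun _ => fc f k)); [apply has_deriv_const|apply has_deriv_e].
    - rewrite fc_D by exact F. ring. }
  induction N as [|N IH]; [apply H|].
  cbn [ps]. apply (has_deriv_plus (fun s => ps (fun k => (fc f k * e k s)%C) N)); [exact IH|].
  apply has_deriv_plus; apply H.
Qed.

Lemma Dn_trig j f N : smooth f -> Dn j (trig f N) = trig (Dn j f) N.
Proof.
  revert f; induction j as [|j IH]; intros f F; [reflexivity|].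
  simpl. rewrite D_trig by exact F. apply IH. now apply smooth_D.
Qed.

(** Differentiation commutes with partial sums, so the uniform estimate applies to each [Dn j f]; it
    uses two further derivatives, hence [k + 2]. *)
Lemma trig_dense k f : smooth f -> forall eps, 0 < eps ->
  exists N0, forall N, (N0 <= N)%nat -> bounded_to k eps (fun t => (f t - trig f N t)%C).
Proof.
  intros F eps He. destruct (smooth_bounded_to (k + 2) f F) as [M [M0 HM]].
  destruct (nfloor_ex (4 * M / eps)) as [N0 HN0]; [apply Rdiv_le_0_compat; lra|].
  exists (S N0). intros N HN j t Hj.
  rewrite Dn_minus by (auto using smooth_trig). rewrite Dn_trig by exact F.
  eapply Rle_trans; [apply trig_error with (M := M); [now apply smooth_Dn| |lia]|].
  - intros s.
    replace (Dn 2 (Dn j f) s) with (Dn (S (S j)) f s) by now rewrite (Dn_out (S j)), (Dn_out j).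
    apply HM; lia.
  - apply le_INR in HN. rewrite S_INR in HN. pose proof (pos_INR N0).
    apply Rle_div_l; [lra|]. destruct HN0 as [_ HN0].
    apply Rlt_div_l in HN0; [|lra]. nra.
Qed.

(** * Pseudofunctions *)

(** Functionals on complex-valued smooth functions, so that exponentials can be inserted directly;
    [complexify] later links them with distributions defined on real test functions. *)
Definition clinear (L : (R -> C) -> C) : Prop :=
  forall f g a b, smooth f -> smooth g ->
    L (fun t => (a * f t + b * g t)%C) = (a * L f + b * L g)%C.

Definition cdist (L : (R -> C) -> C) : Prop :=
  clinear L /\ exists K k, 0 <= K /\
    forall f M, smooth f -> bounded_to k M f -> Cmod (L f) <= K * M.

Lemma clinear_ext (L : (R -> C) -> C) f g : (forall t, f t = g t) -> L f = L g.
Proof. intros H. now rewrite (functional_extensionality _ _ H). Qed.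

Lemma clinear_plus L f g : clinear L -> smooth f -> smooth g ->
  L (fun t => (f t + g t)%C) = (L f + L g)%C.
Proof.
  intros H F G. rewrite (clinear_ext L _ (fun t => (1 * f t + 1 * g t)%C)) by (intros; ring).
  rewrite H by assumption. ring.
Qed.

Lemma clinear_minus L f g : clinear L -> smooth f -> smooth g ->
  L (fun t => (f t - g t)%C) = (L f - L g)%C.
Proof.
  intros H F G. rewrite (clinear_ext L _ (fun t => (1 * f t + - (1) * g t)%C)) by (intros; ring).
  rewrite H by assumption. ring.
Qed.

Lemma clinear_scal L c f : clinear L -> smooth f -> L (fun t => (c * f t)%C) = (c * L f)%C.
Proof.
  intros H F. rewrite (clinear_ext L _ (fun t => (c * f t + 0 * f t)%C)) by (intros; ring).
  rewrite H by assumption. ring.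
Qed.

Lemma clinear_0 L : clinear L -> L (fun _ => RtoC 0) = RtoC 0.
Proof.
  intros H. rewrite (clinear_ext L _ (fun t => (0 * (fun _ => RtoC 0) t)%C)) by (intros; ring).
  rewrite clinear_scal; [ring|exact H|apply smooth_const].
Qed.

Lemma clinear_ps L (f : Z -> R -> C) N : clinear L -> (forall k, smooth (f k)) ->
  L (fun t => ps (fun k => f k t) N) = ps (fun k => L (f k)) N.
Proof.
  intros H F. induction N as [|N IH]; [reflexivity|].
  cbn [ps]. rewrite clinear_plus; auto using smooth_ps, smooth_plus.
  rewrite IH, clinear_plus; auto.
Qed.

(** Summing the Fourier series of [f], the growth of the coefficients of [L] against the decay
    O(|k|^-3) leaves O(|k|^-2). The order and the constant of [L] serve only to pass to the limit of
    the partial sums, so the final bound involves [B] alone. *)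
Lemma cdist_fourier_bound L B : cdist L -> (forall k, Cmod (L (e k)) <= B * (1 + Rabs (IZR k))) ->
  forall f M, smooth f -> bounded_to 3 M f -> Cmod (L f) <= 20 * B * M.
Proof.
  intros [Lin [K [k [K0 HK]]]] HB f M F HM.
  assert (M0 := bounded_to_nonneg _ _ _ HM).
  assert (B0 : 0 <= B).
  { specialize (HB 0%Z). rewrite Rabs_R0 in HB. pose proof (Cmod_ge_0 (L (e 0))). lra. }
  assert (T : forall N, Cmod (L (trig f N)) <= 20 * B * M).
  { intros N. unfold trig. rewrite (clinear_ps L (fun k t => (fc f k * e k t)%C))
      by (auto; intros; apply smooth_scal, smooth_e).
    (* The 5 is that of [ps_bound]; the 4 is the 2 of [fc_bound] times the 2 of [1 + r <= 2 * r] for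
       [r >= 1]. *)
    replace (20 * B * M) with (5 * (4 * M * B)) by ring. apply ps_bound.
    - rewrite clinear_scal by auto using smooth_e. rewrite Cmod_mult.
      specialize (HB 0%Z). rewrite Rabs_R0 in HB.
      assert (Cmod (fc f 0) <= 2 * M) by (apply fc_bound; [exact F|intros t; apply (HM O t); lia]).
      pose proof (Cmod_ge_0 (L (e 0))); pose proof (Cmod_ge_0 (fc f 0)).
      apply Rle_trans with (2 * M * B); [apply Rmult_le_compat; lra|nra].
    - intros j Hj. rewrite clinear_scal by auto using smooth_e. rewrite Cmod_mult.
      assert (H1 : 1 <= Rabs (IZR j)) by (rewrite <- abs_IZR; apply IZR_le; lia).
      assert (H3 : Cmod (fc f j) <= 2 * M / Rabs (IZR j) ^ 3).
      { apply fc_decay_div; [exact F|exact Hj|intros t; apply (HM 3%nat t); lia]. }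
      specialize (HB j). rewrite <- pow2_abs. set (r := Rabs (IZR j)) in *.
      apply Rle_trans with (2 * M / r ^ 3 * (B * (2 * r))).
      + apply Rmult_le_compat; auto using Cmod_ge_0. nra.
      + right; field; lra. }
  apply Rnot_lt_le; intros Hlt.
  (* An approximation of [f] this close in C^k moves [L f] by at most [K * eps], less than the
     supposed excess; [K + 1] covers [K = 0]. *)
  set (eps := (Cmod (L f) - 20 * B * M) / (K + 1)).
  assert (He : 0 < eps) by (apply Rdiv_lt_0_compat; lra).
  destruct (trig_dense k f F eps He) as [N HN]. specialize (HN N ltac:(lia)).
  apply HK in HN; [|apply smooth_minus; auto using smooth_trig].
  rewrite clinear_minus in HN by auto using smooth_trig.
  specialize (T N).
  pose proof (Cmod_triangle (L f - L (trig f N)) (L (trig f N))) as Tr.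
  replace (L f - L (trig f N) + L (trig f N))%C with (L f) in Tr by ring.
  assert (E : eps * (K + 1) = Cmod (L f) - 20 * B * M) by (unfold eps; field; lra).
  nra.
Qed.

Definition mulL (L : (R -> C) -> C) (g : R -> C) (f : R -> C) : C := L (fun t => (g t * f t)%C).

Lemma cdist_mulL L g : cdist L -> smooth g -> cdist (mulL L g).
Proof.
  intros [Lin [K [k [K0 HK]]]] G. split.
  - intros f h a b F H. unfold mulL.
    rewrite (clinear_ext L _ (fun t => (a * (g t * f t) + b * (g t * h t))%C)) by (intros; ring).
    apply Lin; now apply smooth_mult.
  - destruct (bounded_to_mult k g G) as [A [A0 HA]].
    exists (K * A), k. split; [nra|]. intros f M F HM. rewrite Rmult_assoc.
    apply HK; [now apply smooth_mult|now apply HA].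
Qed.

Lemma cdist_affine L (n : Z) v : cdist L -> cdist (fun f => L (fun t => f (IZR n * t + v))).
Proof.
  intros [Lin [K [k [K0 HK]]]]. split.
  - intros f h a b F H.
    apply (Lin (fun t => f (IZR n * t + v)) (fun t => h (IZR n * t + v))); now apply smooth_affine.
  - destruct (bounded_to_affine k (IZR n) v) as [A [A0 HA]].
    exists (K * A), k. split; [nra|]. intros f M F HM. rewrite Rmult_assoc.
    apply HK; [now apply smooth_affine|now apply HA].
Qed.

(* [L (e k)] is the Fourier coefficient of index [- k]; the condition is symmetric in [k]. *)
Definition pseudofunction (L : (R -> C) -> C) : Prop :=
  cdist L /\ forall eps, 0 < eps -> exists N : nat, forall k : Z,
    (Z.of_nat N < Z.abs k)%Z -> Cmod (L (e k)) < eps.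

Lemma pseudofunction_bounded L : pseudofunction L -> exists B, 0 < B /\ forall k, Cmod (L (e k)) <= B.
Proof.
  intros [_ H]. destruct (H 1 Rlt_0_1) as [N HN].
  assert (F : forall n : nat, exists B, 0 < B /\ forall k, (Z.abs k <= Z.of_nat n)%Z -> Cmod (L (e k)) <= B).
  { induction n as [|n [B [B0 HB]]].
    - exists (Cmod (L (e 0)) + 1). split; [pose proof (Cmod_ge_0 (L (e 0))); lra|].
      intros k Hk. replace k with 0%Z by lia. lra.
    - pose proof (Cmod_ge_0 (L (e (Z.of_nat (S n))))) as P1. pose proof (Cmod_ge_0 (L (e (- Z.of_nat (S n))))) as P2.
      exists (B + Cmod (L (e (Z.of_nat (S n)))) + Cmod (L (e (- Z.of_nat (S n))))). split; [lra|].
      intros k Hk. destruct (Z.le_gt_cases (Z.abs k) (Z.of_nat n)) as [Hn|Hn].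
      + specialize (HB k Hn); lra.
      + assert (E : k = Z.of_nat (S n) \/ k = (- Z.of_nat (S n))%Z) by lia.
        destruct E as [-> | ->]; lra. }
  destruct (F N) as [B [B0 HB]]. exists (B + 1); split; [lra|]. intros k.
  destruct (Z.le_gt_cases (Z.abs k) (Z.of_nat N)) as [Hn|Hn]; [specialize (HB k Hn)|specialize (HN k Hn)]; lra.
Qed.

(** Multiplying by [e m] only translates the coefficients, so the bound is uniform in [m]. *)
Lemma mulL_e_bound L B m : cdist L -> (forall k, Cmod (L (e k)) <= B) ->
  forall f M, smooth f -> bounded_to 3 M f -> Cmod (L (fun t => (f t * e m t)%C)) <= 20 * B * M.
Proof.
  intros HL HB f M F HM.
  rewrite (clinear_ext L _ (fun t => (e m t * f t)%C)) by (intros; ring).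
  apply (cdist_fourier_bound (mulL L (e m)) B); auto using cdist_mulL, smooth_e.
  intros k. unfold mulL. rewrite (clinear_ext L _ (e (m + k))) by (intros; now rewrite e_plus).
  specialize (HB (m + k)%Z). pose proof (Rabs_pos (IZR k)). pose proof (Cmod_ge_0 (L (e (m + k)))). nra.
Qed.

Lemma ps_shift_small (c : Z -> C) (a : Z -> C) N :
  (forall eps, 0 < eps -> exists N : nat, forall k : Z, (Z.of_nat N < Z.abs k)%Z -> Cmod (c k) < eps) ->
  forall eps, 0 < eps -> exists n : nat, forall m : Z, (Z.of_nat n < Z.abs m)%Z ->
    Cmod (ps (fun k => (a k * c (k + m)%Z)%C) N) < eps.
Proof.
  intros Hc.
  assert (one : forall k eps, 0 < eps -> exists n : nat, forall m : Z, (Z.of_nat n < Z.abs m)%Z ->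
    Cmod (a k * c (k + m)%Z) < eps).
  { intros k eps He. pose proof (Cmod_ge_0 (a k)) as Ha.
    destruct (Hc (eps / (Cmod (a k) + 1))) as [n Hn]; [apply Rdiv_lt_0_compat; lra|].
    exists (n + Z.to_nat (Z.abs k))%nat. intros m Hm. specialize (Hn (k + m)%Z ltac:(lia)).
    rewrite Cmod_mult. apply Rlt_div_r in Hn; [|lra]. pose proof (Cmod_ge_0 (c (k + m)%Z)). nra. }
  induction N as [|N IH]; intros eps He; [now apply one|].
  destruct (IH (eps / 3)) as [n1 H1]; [lra|].
  destruct (one (Z.of_nat (S N)) (eps / 3)) as [n2 H2]; [lra|].
  destruct (one (- Z.of_nat (S N))%Z (eps / 3)) as [n3 H3]; [lra|].
  exists (n1 + n2 + n3)%nat. intros m Hm. cbn [ps].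
  specialize (H1 m ltac:(lia)). specialize (H2 m ltac:(lia)). specialize (H3 m ltac:(lia)).
  eapply Rle_lt_trans; [apply Cmod_triangle|].
  eapply Rle_lt_trans; [apply Rplus_le_compat_l, Cmod_triangle|]. lra.
Qed.

(** Split [g] into a partial sum of its Fourier series and a remainder small in C^3. The first
    yields a finite combination of translates of a null sequence, the second is small uniformly in
    [m]. *)
Lemma pseudofunction_mulL L g : pseudofunction L -> smooth g -> pseudofunction (mulL L g).
Proof.
  intros HL G. split; [apply cdist_mulL; [apply HL|exact G]|].
  intros eps He. destruct (pseudofunction_bounded L HL) as [B [B0 HB]].
  destruct HL as [HL Hc]. destruct HL as [Lin HK]. assert (HL : cdist L) by now split.
  (* The denominator 40 turns the bound [20 * B * M] of [mulL_e_bound] into [eps / 2]. *)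
  destruct (trig_dense 3 g G (eps / (40 * B))) as [N HN]; [apply Rdiv_lt_0_compat; lra|].
  specialize (HN N ltac:(lia)).
  destruct (ps_shift_small (fun k => L (e k)) (fc g) N Hc (eps / 2)) as [n Hn]; [lra|].
  exists n. intros m Hm. specialize (Hn m Hm). unfold mulL.
  assert (S1 : smooth (fun t => ((g t - trig g N t) * e m t)%C))
    by (apply smooth_mult; auto using smooth_minus, smooth_trig, smooth_e).
  assert (S2 : smooth (fun t => (trig g N t * e m t)%C))
    by (apply smooth_mult; auto using smooth_trig, smooth_e).
  rewrite (clinear_ext L _ (fun t => ((g t - trig g N t) * e m t + trig g N t * e m t)%C)) by (intros; ring).
  rewrite (clinear_plus L _ _ Lin S1 S2).
  apply (mulL_e_bound L B m) in HN; auto using smooth_minus, smooth_trig.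
  rewrite (clinear_ext L (fun t => (trig g N t * e m t)%C) (fun t => ps (fun k => (fc g k * e (k + m) t)%C) N)).
  2: { intros t. unfold trig. rewrite Cmult_comm, <- ps_scal. apply ps_ext. intros k. rewrite e_plus; ring. }
  rewrite (clinear_ps L (fun k t => (fc g k * e (k + m) t)%C)) by (auto; intros; apply smooth_scal, smooth_e).
  rewrite (ps_ext _ (fun k => (fc g k * L (e (k + m)))%C)) by (intros; apply clinear_scal; auto using smooth_e).
  eapply Rle_lt_trans; [apply Cmod_triangle|].
  replace (20 * B * (eps / (40 * B))) with (eps / 2) in HN by (field; lra). lra.
Qed.

(* [(a, k)] stands for [a z^(k+1)], so that there is no constant term. *)
Fixpoint tpoly (l : list (C * nat)) (t : R) : C :=
  match l with
  | nil => RtoC 0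
  | (a, k) :: l => (a * e (Z.of_nat (S k)) t + tpoly l t)%C
  end.

Lemma smooth_tpoly l : smooth (tpoly l).
Proof.
  induction l as [|[a k] l IH]; [apply smooth_const|].
  apply (smooth_plus (fun t => (a * e (Z.of_nat (S k)) t)%C)); [apply smooth_scal, smooth_e|exact IH].
Qed.

(* The frequencies of [tpoly l (n t + v)] are at least [n], so they only meet the coefficients of [L]
   of index at most [m - n]: these are small unless [m] is nearly [n], where [eps * (1 + |m|)] is large. *)
Lemma tpoly_dilate_small L l : pseudofunction L -> forall eps, 0 < eps ->
  exists n0 : nat, forall (n : nat) v (m : Z), (n0 <= n)%nat ->
    let d := L (fun t => (tpoly l (IZR (Z.of_nat n) * t + v) * e (- m) t)%C) in
    ((m <= 0)%Z -> Cmod d <= eps) /\ Cmod d <= eps * (1 + Rabs (IZR m)).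
Proof.
  intros HL. destruct (pseudofunction_bounded L HL) as [B [B0 HB]].
  destruct HL as [[Lin HK] Hc].
  induction l as [|[a k] l IH]; intros eps He.
  - exists O. intros n v m _ d.
    assert (E : d = RtoC 0).
    { unfold d. rewrite (clinear_ext L _ (fun _ => RtoC 0)) by (intros; simpl; ring). now apply clinear_0. }
    rewrite E, Cmod_0. pose proof (Rabs_pos (IZR m)). split; [lra|nra].
  - destruct (IH (eps / 2)) as [n1 H1]; [lra|].
    pose proof (Cmod_ge_0 a) as Ha.
    destruct (Hc (eps / 2 / (Cmod a + 1))) as [N HN]; [repeat apply Rdiv_lt_0_compat; lra|].
    (* Once [m > p], the allowance [eps / 2 * m] exceeds the crude bound [Cmod a * B]. *)
    destruct (nfloor_ex (Cmod a * B / (eps / 2))) as [p Hp]; [apply Rdiv_le_0_compat; nra|].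
    exists (n1 + N + p + 1)%nat. intros n v m Hn d.
    specialize (H1 n v m ltac:(lia)). cbv zeta in H1. destruct H1 as [H1a H1b].
    (* The frequency at which the monomial [(a, k)], dilated by [n] and multiplied by [e (- m)],
       meets [L]. For [m <= 0] it is at least [n > N]; conversely [|j| <= N] forces
       [m >= n - N > p]. *)
    set (j := (Z.of_nat n * Z.of_nat (S k) - m)%Z).
    assert (E : d = (a * eit (IZR (Z.of_nat (S k)) * v) * L (e j)
               + L (fun t => (tpoly l (IZR (Z.of_nat n) * t + v)%R * e (- m) t)%C))%C).
    { unfold d. rewrite <- clinear_scal, <- clinear_plus; auto using smooth_e, smooth_scal.
      - apply clinear_ext. intros t. cbn [tpoly]. rewrite e_affine. unfold j, Z.sub. rewrite e_plus. ring.
      - apply smooth_mult; [|apply smooth_e]. apply smooth_affine, smooth_tpoly. }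
    assert (T : Cmod d <= Cmod a * Cmod (L (e j)) + Cmod (L (fun t => (tpoly l (IZR (Z.of_nat n) * t + v)%R * e (- m) t)%C))).
    { rewrite E. eapply Rle_trans; [apply Cmod_triangle|]. rewrite !Cmod_mult, Cmod_eit. lra. }
    pose proof (Cmod_ge_0 (L (e j))) as Hj0. pose proof (Rabs_pos (IZR m)) as Hm0.
    assert (S : (Z.of_nat N < Z.abs j)%Z -> Cmod a * Cmod (L (e j)) <= eps / 2).
    { intros Hj. specialize (HN j Hj). apply Rlt_div_r in HN; [|lra]. nra. }
    split.
    + intros Hm. specialize (H1a Hm). assert (Hj : (Z.of_nat N < Z.abs j)%Z) by (unfold j; nia).
      specialize (S Hj). lra.
    + destruct (Z.lt_ge_cases (Z.of_nat N) (Z.abs j)) as [Hj|Hj]; [specialize (S Hj); nra|].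
      assert (Hm : (Z.of_nat p + 1 <= m)%Z) by (unfold j in Hj; nia).
      apply IZR_le in Hm. rewrite plus_IZR, <- INR_IZR_INZ in Hm.
      destruct Hp as [_ Hp]. apply Rlt_div_l in Hp; [|lra].
      specialize (HB j). assert (Cmod a * Cmod (L (e j)) <= Cmod a * B) by (apply Rmult_le_compat_l; lra).
      pose proof (Rle_abs (IZR m)). nra.
Qed.

(** Dilation by [n] would ruin the C^3 norm of [r], so it is moved to the functional: [f] goes to
    [L] applied to [e (- m) t * f (n t + v)]. Up to unimodular factors the coefficients of this
    functional are among those of [L], so [B] still bounds them, whatever [n], [v] and [m]. *)
Lemma perturb_small L B l r : pseudofunction L -> (forall k, Cmod (L (e k)) <= B) ->
  forall eps, 0 < eps -> smooth r -> bounded_to 3 (eps / (40 * B)) r -> 0 < B ->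
  exists n0 : nat, forall (n : nat) v (m : Z), (n0 <= n)%nat ->
    let d := L (fun t => ((tpoly l (IZR (Z.of_nat n) * t + v) - r (IZR (Z.of_nat n) * t + v)%R) * e (- m) t)%C) in
    ((m <= 0)%Z -> Cmod d <= eps) /\ Cmod d <= eps * (1 + Rabs (IZR m)).
Proof.
  intros HL HB eps He Sr Hr B0.
  destruct (tpoly_dilate_small L l HL (eps / 2)) as [n0 H0]; [lra|].
  exists n0. intros n v m Hn d. specialize (H0 n v m Hn). cbv zeta in H0. destruct H0 as [Ha Hb].
  destruct HL as [HL _]. assert (HL' := HL). destruct HL' as [Lin _].
  set (nz := Z.of_nat n) in *.
  assert (E : d = (L (fun t => (tpoly l (IZR nz * t + v)%R * e (- m) t)%C)
                   - L (fun t => (r (IZR nz * t + v)%R * e (- m) t)%C))%C).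
  { unfold d. rewrite <- clinear_minus; auto.
    - apply clinear_ext. intros; ring.
    - apply smooth_mult; [apply smooth_affine, smooth_tpoly|apply smooth_e].
    - apply smooth_mult; [now apply smooth_affine|apply smooth_e]. }
  assert (Rb : Cmod (L (fun t => (r (IZR nz * t + v)%R * e (- m) t)%C)) <= eps / 2).
  { rewrite (clinear_ext L _ (fun t => (e (- m) t * r (IZR nz * t + v)%R)%C)) by (intros; ring).
    replace (eps / 2) with (20 * B * (eps / (40 * B))) by (field; lra).
    apply (cdist_fourier_bound (fun f => mulL L (e (- m)) (fun t => f (IZR nz * t + v)))); auto.
    - apply cdist_affine. apply cdist_mulL; auto using smooth_e.
    - intros k. unfold mulL.
      rewrite (clinear_ext L _ (fun t => (eit (IZR k * v) * e (- m + nz * k) t)%C))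
        by (intros; rewrite e_affine, e_plus; ring).
      rewrite clinear_scal, Cmod_mult, Cmod_eit by auto using smooth_e.
      specialize (HB (- m + nz * k)%Z). pose proof (Rabs_pos (IZR k)).
      pose proof (Cmod_ge_0 (L (e (- m + nz * k)))). nra. }
  assert (T : Cmod d <= Cmod (L (fun t => (tpoly l (IZR nz * t + v)%R * e (- m) t)%C)) + eps / 2).
  { rewrite E. eapply Rle_trans; [apply Cmod_triangle_minus|]. lra. }
  pose proof (Rabs_pos (IZR m)). split; [intros Hm; specialize (Ha Hm); lra|nra].
Qed.

(** * Localizing analytic polynomials *)

(** The powers of [/ x] make the family closed under differentiation: the derivative of [flat k]
    combines [flat (S k)] and [flat (S (S k))]. *)
Definition flat (k : nat) (x : R) : R :=
  if Rlt_dec 0 x then (/ x) ^ k * exp (- / x) else 0.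

Lemma flat_pos k x : 0 < x -> flat k x = (/ x) ^ k * exp (- / x).
Proof. intros H. unfold flat. now destruct (Rlt_dec 0 x). Qed.

Lemma flat_neg k x : x <= 0 -> flat k x = 0.
Proof. intros H. unfold flat. destruct (Rlt_dec 0 x); [lra|reflexivity]. Qed.

Lemma pow_le_exp y n : 0 <= y -> y ^ n <= INR (fact n) * exp y.
Proof.
  intros Hy. pose proof (exp_ge_taylor y n Hy) as H.
  assert (y ^ n / INR (fact n) <= sum_f_R0 (fun k => y ^ k / INR (fact k)) n).
  { destruct n as [|n]; [simpl; lra|]. rewrite tech5.
    assert (0 <= sum_f_R0 (fun k => y ^ k / INR (fact k)) n).
    { apply cond_pos_sum. intros k. apply Rdiv_le_0_compat; [now apply pow_le|apply INR_fact_lt_0]. }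
    lra. }
  pose proof (INR_fact_lt_0 n) as F.
  assert (K : y ^ n / INR (fact n) <= exp y) by lra.
  apply Rle_div_l in K; lra.
Qed.

(** This is [y ^ (k + 2) <= (k + 2)! * exp y] at [y = / x]; a quadratic bound gives derivative 0 at
    the junction point. *)
Lemma flat_bound k x : Rabs (flat k x) <= INR (fact (k + 2)) * x ^ 2.
Proof.
  pose proof (INR_fact_lt_0 (k + 2)) as F. pose proof (pow2_ge_0 x).
  destruct (Rlt_dec 0 x) as [Hx|Hx].
  - rewrite flat_pos by exact Hx.
    assert (0 < / x) by now apply Rinv_0_lt_compat.
    pose proof (pow_le_exp (/ x) (k + 2) ltac:(lra)) as P.
    rewrite Rabs_pos_eq by (apply Rmult_le_pos; [apply pow_le; lra|left; apply exp_pos]).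
    rewrite exp_Ropp. pose proof (exp_pos (/ x)) as E.
    rewrite pow_add in P. set (p := (/ x) ^ k) in *.
    apply Rmult_le_reg_r with (exp (/ x) * (/ x) ^ 2); [apply Rmult_lt_0_compat; [lra|apply pow_lt; lra]|].
    replace (p * / exp (/ x) * (exp (/ x) * (/ x) ^ 2)) with (p * (/ x) ^ 2) by (field; lra).
    replace (INR (fact (k + 2)) * x ^ 2 * (exp (/ x) * (/ x) ^ 2)) with (INR (fact (k + 2)) * exp (/ x)) by (field; lra).
    exact P.
  - rewrite flat_neg, Rabs_R0 by lra. nra.
Qed.

Lemma is_derive_0_of_quadratic (h : R -> R) A : (forall x, Rabs (h x) <= A * x ^ 2) -> is_derive h 0 0.
Proof.
  intros H. apply is_derive_Reals. intros eps He.
  assert (A0 : 0 <= A).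
  { specialize (H 1). pose proof (Rabs_pos (h 1)). lra. }
  assert (Hd : 0 < eps / (A + 1)) by (apply Rdiv_lt_0_compat; lra).
  exists (mkposreal _ Hd). intros y Hy Hyd. simpl in Hyd.
  assert (h0 : h 0 = 0).
  { specialize (H 0). replace (A * 0 ^ 2) with 0 in H by ring. pose proof (Rabs_pos (h 0)).
    destruct (Req_dec (h 0) 0) as [E|E]; [exact E|]. apply Rabs_pos_lt in E. lra. }
  rewrite Rplus_0_l, h0, !Rminus_0_r. unfold Rdiv; rewrite Rabs_mult, Rabs_inv.
  pose proof (Rabs_pos_lt y Hy) as Yp. specialize (H y). rewrite <- pow2_abs in H.
  apply Rlt_div_l; [exact Yp|].
  apply Rlt_div_r in Hyd; [|lra]. nra.
Qed.

Lemma flat_derive k x : is_derive (flat k) x (- INR k * flat (S k) x + flat (S (S k)) x).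
Proof.
  destruct (total_order_T x 0) as [[Hx|Hx]|Hx].
  - rewrite !flat_neg by lra. apply (is_derive_ext_loc (fun _ => 0)).
    + apply (filter_imp (fun y => y < 0)); [intros y Hy; now rewrite flat_neg by lra|].
      now apply open_lt.
    + evar_last; [apply (is_derive_const (K := R_AbsRing) (V := R_NormedModule))|].
      change (0 = - INR k * 0 + 0). ring.
  - subst. rewrite !flat_neg by lra. replace (- INR k * 0 + 0) with 0 by ring.
    apply is_derive_0_of_quadratic with (INR (fact (k + 2))). apply flat_bound.
  - rewrite !flat_pos by lra.
    apply (is_derive_ext_loc (fun x => (/ x) ^ k * exp (- / x))).
    + apply (filter_imp (fun y => 0 < y)); [intros y Hy; now rewrite flat_pos by lra|].
      now apply open_gt.
    + destruct k as [|k].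
      * auto_derive; [lra|]. simpl. field; lra.
      * evar_last.
        { apply (is_derive_mult (K := R_AbsRing) (fun x => (/ x) ^ S k) (fun x => exp (- / x)) x
            (INR (S k) * (- 1 / x ^ 2) * (/ x) ^ k) (exp (- / x) * (/ x ^ 2))).
          - apply (is_derive_pow (fun x => / x)). apply (is_derive_inv (fun x => x)); [apply @is_derive_id|lra].
          - auto_derive; [lra|]. field; lra.
          - apply Rmult_comm. }
        unfold plus, mult; simpl plus; simpl mult. unfold mult; simpl mult.
        change ((INR (S k) * (-1 / x ^ 2) * (/ x) ^ k) * exp (- / x) + (/ x) ^ (S k) * (exp (- / x) * / x ^ 2)
          = - INR (S k) * ((/ x) ^ S (S k) * exp (- / x)) + (/ x) ^ S (S (S k)) * exp (- / x)).
        generalize (INR (S k)); intros s. simpl pow. field; lra.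
Qed.

Lemma smooth_to_flat n k (u u' : R -> R) : (forall t, is_derive u t (u' t)) ->
  (forall n, smooth_to n (fun t => RtoC (u' t))) -> smooth_to n (fun t => RtoC (flat k (u t))).
Proof.
  intros Hu Hs. revert k; induction n as [|n IH]; intros k; [exact I|].
  apply smooth_to_intro with
    (f' := fun t => (RtoC (u' t) * (RtoC (- INR k) * RtoC (flat (S k) (u t)) + RtoC (flat (S (S k)) (u t))))%C).
  - intros t. rewrite <- !RtoC_mult, <- RtoC_plus, <- RtoC_mult. apply has_deriv_real.
    apply (is_derive_comp (flat k) u); [apply flat_derive|apply Hu].
  - apply smooth_to_mult; [apply Hs|].
    apply (smooth_to_plus n (fun t => (RtoC (- INR k) * RtoC (flat (S k) (u t)))%C)); [|apply IH].
    apply (smooth_to_mult n (fun _ => RtoC (- INR k))); [apply smooth_to_const|apply IH].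
Qed.

(** The derivative of [/ B] is a polynomial in [/ B] and the derivative of [B], of order one less,
    so induction on the order closes. *)
Lemma smooth_to_inv n (B : R -> R) : (forall t, B t <> 0) ->
  smooth_to n (fun t => RtoC (B t)) -> smooth_to n (fun t => RtoC (/ B t)).
Proof.
  intros HB. induction n as [|n IH]; intros H; [exact I|].
  assert (H' := smooth_to_pred _ _ H). specialize (IH H'). destruct H as [H1 H2].
  apply smooth_to_intro with
    (f' := fun t => (- (1) * D (fun t => RtoC (B t)) t * (RtoC (/ B t) * RtoC (/ B t)))%C).
  - intros t. destruct (H1 t) as [H1a H1b].
    assert (E : D (fun t => RtoC (B t)) t = RtoC (Derive B t)).
    { apply injective_projections; [reflexivity|]. simpl. apply Derive_const. }
    rewrite E in *. simpl in H1a.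
    apply has_deriv_eq with (RtoC (- Derive B t / (B t) ^ 2)).
    + apply has_deriv_real. now apply is_derive_inv.
    + apply injective_projections; simpl; field; apply HB.
  - apply smooth_to_mult; [|now apply smooth_to_mult].
    apply (smooth_to_mult n (fun _ => (- (1))%C)); [apply smooth_to_const|exact H2].
Qed.

(** A function of [cos t] is periodic at once, and its support becomes a condition on [cos t]: with
    [s = 1] an arc around 1, with [s = -1] the opposite arc. *)
Lemma smooth_cos_bump (s c : R) : smooth (fun t => RtoC (flat 0 (s * (cos t - c)))).
Proof.
  split.
  - intros t. now rewrite cos_plus, cos_2PI, sin_2PI, Rmult_1_r, Rmult_0_r, Rminus_0_r.
  - intros n. apply smooth_to_flat with (u' := fun t => - s * sin t).
    + intros t. auto_derive; [auto|ring].
    + intros m.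
      assert (P : smooth (fun t => (RtoC (- s) * ((- Ci / 2) * (e 1 t - e (-1) t)))%C)).
      { apply smooth_scal, smooth_scal, smooth_minus; apply smooth_e. }
      apply (smooth_ext _ (fun t => RtoC (- s * sin t))) in P; [apply P|].
      intros t. unfold e, eit. replace (-1 * t) with (- (1 * t)) by ring.
      rewrite cos_neg, sin_neg, Rmult_1_l. apply injective_projections; simpl; field.
Qed.

(** * Analytic polynomials with constant term 1, contracting off an arc *)

Lemma tpoly_app l1 l2 t : tpoly (l1 ++ l2) t = (tpoly l1 t + tpoly l2 t)%C.
Proof. induction l1 as [|[a k] l1 IH]; simpl tpoly; [ring|]. rewrite IH; ring. Qed.

Lemma tpoly_mult l1 l2 : exists l, forall t, tpoly l t = (tpoly l1 t * tpoly l2 t)%C.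
Proof.
  induction l1 as [|[a k] l1 [l Hl]].
  - exists nil. intros; simpl; ring.
  - assert (M : exists l', forall t, tpoly l' t = (a * e (Z.of_nat (S k)) t * tpoly l2 t)%C).
    { clear. induction l2 as [|[b j] l2 [l Hl]].
      - exists nil; intros; simpl; ring.
      - exists (((a * b)%C, (k + S j)%nat) :: l). intros t. cbn [tpoly]. rewrite Hl.
        replace (Z.of_nat (S (k + S j))) with (Z.of_nat (S k) + Z.of_nat (S j))%Z by lia.
        rewrite e_plus; ring. }
    destruct M as [l' Hl']. exists (l' ++ l). intros t. rewrite tpoly_app, Hl, Hl'. cbn [tpoly]. ring.
Qed.

(** Powers keep the constant term 1, so smallness off an arc can be amplified without touching the
    mean. *)
Lemma tpoly_pow l N : exists l', forall t, ((1 + tpoly l t) ^ N)%C = (1 + tpoly l' t)%C.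
Proof.
  induction N as [|N [l' IH]].
  - exists nil. intros; simpl; ring.
  - destruct (tpoly_mult l l') as [m Hm]. exists (l ++ l' ++ m).
    intros t. rewrite Cpow_S, IH, !tpoly_app, Hm. ring.
Qed.

Fixpoint row (a : R) (m : nat) : list (C * nat) :=
  match m with O => nil | S m => (RtoC a, m) :: row a m end.

(* [a * (n + 1)] times the analytic part, without constant term, of the Fejer kernel of order [n]. *)
Fixpoint fejer (a : R) (n : nat) : list (C * nat) :=
  match n with O => nil | S n => row a (S n) ++ fejer a n end.

Lemma row_bound a m t : Cmod (tpoly (row a m) t) <= Rabs a * INR m.
Proof.
  induction m as [|m IH]; [simpl; rewrite Cmod_0; lra|].
  cbn [row tpoly]. rewrite S_INR. eapply Rle_trans; [apply Cmod_triangle|].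
  rewrite Cmod_mult, Cmod_e, Cmod_R. lra.
Qed.

Lemma fejer_bound a n t : Cmod (tpoly (fejer a n) t) <= Rabs a * INR n ^ 2.
Proof.
  induction n as [|n IH]; [simpl; rewrite Cmod_0; lra|].
  change (fejer a (S n)) with (row a (S n) ++ fejer a n). rewrite tpoly_app.
  eapply Rle_trans; [apply Cmod_triangle|]. pose proof (row_bound a (S n) t).
  rewrite S_INR in *. pose proof (pos_INR n). pose proof (Rabs_pos a).
  pose proof (Rmult_le_pos _ _ H1 H0). nra.
Qed.

(** The factor [2 - 2 * cos t] clears the denominator of the closed formula for a sum of cosines,
    and the sum telescopes. *)
Lemma row_re a m t : fst (tpoly (row a m) t) * (2 - 2 * cos t)
  = a * (cos t - 1 + cos (INR m * t) - cos (INR (S m) * t)).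
Proof.
  induction m as [|m IH].
  - simpl. rewrite !Rmult_0_l, cos_0, Rmult_1_l. ring.
  - cbn [row tpoly].
    change (fst (RtoC a * e (Z.of_nat (S m)) t + tpoly (row a m) t)%C)
      with (a * cos (IZR (Z.of_nat (S m)) * t) - 0 * sin (IZR (Z.of_nat (S m)) * t)
            + fst (tpoly (row a m) t)).
    rewrite <- INR_IZR_INZ, Rmult_0_l, Rminus_0_r.
    rewrite Rmult_plus_distr_r, IH.
    rewrite (S_INR (S m)), (S_INR m).
    replace (INR m * t) with ((INR m + 1) * t - t) by ring.
    replace ((INR m + 1 + 1) * t) with ((INR m + 1) * t + t) by ring.
    rewrite cos_plus, cos_minus. ring.
Qed.

Lemma fejer_re a n t : fst (tpoly (fejer a n) t) * (2 - 2 * cos t)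
  = a * (INR n * (cos t - 1) + cos t - cos (INR (S n) * t)).
Proof.
  induction n as [|n IH].
  - simpl. rewrite Rmult_1_l. ring.
  - change (fejer a (S n)) with (row a (S n) ++ fejer a n). rewrite tpoly_app.
    change (fst (tpoly (row a (S n)) t + tpoly (fejer a n) t)%C)
      with (fst (tpoly (row a (S n)) t) + fst (tpoly (fejer a n) t)).
    rewrite Rmult_plus_distr_r, IH, row_re, (S_INR n). ring.
Qed.

(** Away from 1 the Fejer kernel is small compared with its order, so its analytic half has real
    part near [- x / 2] before scaling by [a]. A short step [w] in such a direction decreases the
    modulus of [1 + w], since [|1 + w|^2 = 1 + 2 Re w + |w|^2]. *)
Lemma tpoly_contracting c : c < 1 -> exists l rho, 0 < rho < 1 /\
  forall t, cos t <= c -> Cmod (1 + tpoly l t) <= rho.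
Proof.
  intros Hc.
  (* This gives [x * (1 - cos t) >= 4]: the oscillating term, at most 2, then consumes at most half
     of the main term. *)
  destruct (nfloor_ex (4 / (1 - c))) as [n0 Hn0]; [apply Rdiv_le_0_compat; lra|].
  destruct Hn0 as [_ Hn0]. apply Rlt_div_l in Hn0; [|lra].
  set (n := S n0). set (x := INR n).
  assert (Hx : x = INR n0 + 1) by (unfold x, n; apply S_INR).
  assert (x1 : 1 <= x) by (pose proof (pos_INR n0); lra).
  (* With this [a], [2 Re w <= - 1 / (8 x^2)] while [|w|^2 <= 1 / (16 x^2)], whence the value of
     [rho]. *)
  set (a := / (4 * x ^ 3)).
  assert (x3 : 1 <= x ^ 3) by (apply pow_R1_Rle; exact x1).
  assert (x2 : 1 <= x ^ 2) by (apply pow_R1_Rle; exact x1).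
  assert (a0 : 0 < a) by (apply Rinv_0_lt_compat; lra).
  assert (i2 : 0 < / x ^ 2 <= 1).
  { split; [apply Rinv_0_lt_compat; lra|]. rewrite <- Rinv_1. apply Rinv_le_contravar; lra. }
  exists (fejer a n), (sqrt (1 - / (16 * x ^ 2))).
  assert (r2 : / (16 * x ^ 2) = / 16 * / x ^ 2) by (field; lra).
  split.
  { split; [apply sqrt_lt_R0; lra|]. rewrite <- sqrt_1 at 2. apply sqrt_lt_1_alt; lra. }
  intros t Ht. pose proof (fejer_bound a n t) as Hb. pose proof (fejer_re a n t) as Hr.
  fold x in Hb, Hr. rewrite (Rabs_pos_eq a) in Hb by lra.
  revert Hb Hr. generalize (tpoly (fejer a n) t). intros w Hb Hr.
  assert (Ea : a = / (4 * x ^ 3)) by reflexivity. clearbody a x.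
  assert (Hre : fst w <= - (a * x / 4)).
  { apply Rmult_le_reg_r with (2 - 2 * cos t); [lra|]. rewrite Hr.
    pose proof (COS_bound t). pose proof (COS_bound (INR (S n) * t)).
    replace (- (a * x / 4) * (2 - 2 * cos t)) with (a * (- (x / 4) * (2 - 2 * cos t))) by field.
    apply Rmult_le_compat_l; [lra|]. nra. }
  rewrite <- (sqrt_pow2 (Cmod (1 + w))) by apply Cmod_ge_0. apply sqrt_le_1_alt.
  assert (E : Cmod (1 + w) ^ 2 = 1 + 2 * fst w + Cmod w ^ 2).
  { rewrite !Cmod2_alt. generalize w; intros [x' y']. unfold Re, Im. simpl. ring. }
  rewrite E. pose proof (Cmod_ge_0 w).
  assert (Cmod w ^ 2 <= (a * x ^ 2) ^ 2) by (apply pow_incr; lra).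
  replace ((a * x ^ 2) ^ 2) with (/ 16 * / x ^ 2) in * by (rewrite Ea; field; lra).
  replace (a * x / 4) with (/ 16 * / x ^ 2) in Hre by (rewrite Ea; field; lra).
  lra.
Qed.

(** * Powers and their derivatives *)

Lemma smooth_pow q N : smooth q -> smooth (fun t => (q t ^ N)%C).
Proof.
  intros H; induction N as [|N IH]; [exact (smooth_const (RtoC 1))|].
  apply (smooth_mult q (fun t => (q t ^ N)%C) H IH).
Qed.

Lemma has_deriv_pow q n t : smooth q ->
  has_deriv (fun t => (q t ^ S n)%C) t (RtoC (INR (S n)) * q t ^ n * D q t)%C.
Proof.
  intros H; induction n as [|n IH].
  - apply has_deriv_eq with (D q t * 1 + q t * 0)%C; [|simpl; ring].
    apply (has_deriv_mult q (fun _ => RtoC 1)); [now apply smooth_has_deriv|apply has_deriv_const].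
  - apply has_deriv_eq with (D q t * q t ^ S n + q t * (RtoC (INR (S n)) * q t ^ n * D q t))%C.
    + apply (has_deriv_mult q (fun t => (q t ^ S n)%C)); [now apply smooth_has_deriv|exact IH].
    + rewrite (S_INR (S n)), RtoC_plus, (Cpow_S _ n). ring.
Qed.

Lemma D_zero_open (f : R -> C) c : (forall t, c < cos t -> f t = RtoC 0) -> forall t, c < cos t -> D f t = RtoC 0.
Proof.
  intros H t Ht.
  assert (L : locally t (fun s => c < cos s)).
  { apply (continuous_cos t). now apply open_gt. }
  apply injective_projections; simpl.
  - rewrite (Derive_ext_loc _ (fun _ => 0)); [apply Derive_const|].
    apply (filter_imp (fun s => c < cos s)); [|exact L]. intros s Hs; now rewrite H.
  - rewrite (Derive_ext_loc _ (fun _ => 0)); [apply Derive_const|].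
    apply (filter_imp (fun s => c < cos s)); [|exact L]. intros s Hs; now rewrite H.
Qed.

(** By Bernoulli's inequality a linear factor is absorbed by any slightly larger ratio. *)
Lemma nat_mult_geometric s u : 0 < s < u -> exists A, 0 <= A /\
  forall n, INR (S n) * s ^ n <= A * u ^ S n.
Proof.
  intros [Hs Hu]. set (h := u / s - 1).
  assert (h0 : 0 < h).
  { unfold h. apply Rlt_0_minus, Rlt_div_r; lra. }
  exists (/ (h * s)). split; [left; apply Rinv_0_lt_compat; nra|]. intros n.
  assert (B : 1 + INR (S n) * h <= (1 + h) ^ S n) by now apply poly.
  assert (U : u ^ S n = s ^ S n * (1 + h) ^ S n).
  { rewrite <- Rpow_mult_distr. f_equal. unfold h. field; lra. }
  rewrite U. assert (0 < s ^ n) by now apply pow_lt.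
  replace (/ (h * s) * (s ^ S n * (1 + h) ^ S n)) with (s ^ n * ((1 + h) ^ S n / h)) by (simpl; field; lra).
  rewrite Rmult_comm. apply Rmult_le_compat_l; [lra|]. apply Rle_div_r; lra.
Qed.

(** Each derivative of [q ^ N] costs a factor [N], absorbed by enlarging the ratio a little; this is
    why [s] is an arbitrary number above [rho] and varies in the induction. Where [q] is not
    controlled, [f] and its derivatives vanish. *)
Lemma bounded_to_pow k q c rho : smooth q -> 0 < rho -> (forall t, cos t <= c -> Cmod (q t) <= rho) ->
  forall s f, rho < s -> smooth f -> (forall t, c < cos t -> f t = RtoC 0) ->
  exists A, 0 <= A /\ forall N, bounded_to k (A * s ^ N) (fun t => (f t * q t ^ N)%C).
Proof.
  intros Q r0 Hq. induction k as [|k IH]; intros s f Hs F Hf.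
  - destruct (smooth_bounded f F) as [B [B0 HB]]. exists B; split; [exact B0|].
    intros N j t Hj. replace j with O by lia. simpl. rewrite Cmod_mult, Cmod_pow.
    destruct (Rle_lt_dec (cos t) c) as [Ht|Ht].
    + apply Rmult_le_compat; auto using Cmod_ge_0; [apply pow_le, Cmod_ge_0|].
      apply pow_incr; split; [apply Cmod_ge_0|]. specialize (Hq t Ht); lra.
    + rewrite Hf, Cmod_0, Rmult_0_l by exact Ht. apply Rmult_le_pos; [exact B0|apply pow_le; lra].
  - destruct (IH s f Hs F Hf) as [A0 [A00 H0]].
    destruct (IH s (D f) Hs) as [A1 [A10 H1]]; [now apply smooth_D|now apply D_zero_open|].
    (* The room between [s1] and [s] pays for the factor [N] of this derivative. *)
    set (s1 := (rho + s) / 2).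
    destruct (IH s1 (fun t => (f t * D q t)%C)) as [A2 [A20 H2]];
      [unfold s1; lra|auto using smooth_mult, smooth_D|intros; rewrite Hf by assumption; ring|].
    destruct (nat_mult_geometric s1 s) as [A3 [A30 H3]]; [unfold s1; lra|].
    exists (A0 + A1 + A2 * A3). split; [nra|]. intros N j t Hj.
    assert (sN : 0 < s ^ N) by (apply pow_lt; lra).
    assert (A23 : 0 <= A2 * A3) by nra.
    destruct j as [|j].
    + apply Rle_trans with (A0 * s ^ N); [apply (H0 N O t); lia|nra].
    + cbn [Dn]. destruct N as [|n].
      * assert (E : (fun t => (f t * q t ^ 0)%C) = f) by (apply functional_extensionality; intros; simpl; ring).
        rewrite E. specialize (H1 O j t ltac:(lia)).
        assert (E' : (fun t => (D f t * q t ^ 0)%C) = D f) by (apply functional_extensionality; intros; simpl; ring).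
        rewrite E' in H1. simpl in *. nra.
      * assert (E : D (fun t => (f t * q t ^ S n)%C) =
          fun t => (D f t * q t ^ S n + RtoC (INR (S n)) * (f t * D q t * q t ^ n))%C).
        { apply D_unique. intros x.
          apply has_deriv_eq with (D f x * q x ^ S n + f x * (RtoC (INR (S n)) * q x ^ n * D q x))%C; [|ring].
          apply (has_deriv_mult f (fun t => (q t ^ S n)%C)); [now apply smooth_has_deriv|now apply has_deriv_pow]. }
        assert (S1 : smooth (fun t => (D f t * q t ^ S n)%C)) by (apply smooth_mult; auto using smooth_D, smooth_pow).
        assert (S2 : smooth (fun t => (f t * D q t * q t ^ n)%C))
          by (apply smooth_mult; auto using smooth_mult, smooth_D, smooth_pow).
        rewrite E, Dn_plus, Dn_scal by auto using smooth_scal.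
        eapply Rle_trans; [apply Cmod_triangle|]. rewrite Cmod_mult, Cmod_R, Rabs_pos_eq by apply pos_INR.
        specialize (H1 (S n) j t ltac:(lia)). specialize (H2 n j t ltac:(lia)). specialize (H3 n).
        pose proof (pos_INR (S n)).
        assert (INR (S n) * Cmod (Dn j (fun t => (f t * D q t * q t ^ n)%C) t) <= A2 * A3 * s ^ S n).
        { apply Rle_trans with (INR (S n) * (A2 * s1 ^ n)); [now apply Rmult_le_compat_l|].
          replace (INR (S n) * (A2 * s1 ^ n)) with (A2 * (INR (S n) * s1 ^ n)) by ring. rewrite Rmult_assoc.
          now apply Rmult_le_compat_l. }
        nra.
Qed.

(* Off the arc [cos t > c] the analytic polynomial [(1 + tpoly l)^N] is as small as we like, so cutting it off
   there costs little although its constant term stays [1]. *)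
Lemma localizer c eps : c < 1 -> 0 < eps -> exists l F r, smooth F /\ smooth r /\
  (forall t, cos t <= c -> F t = RtoC 0) /\
  (forall t, (F t - 1 = tpoly l t - r t)%C) /\ bounded_to 3 eps r.
Proof.
  intros Hc He. set (c2 := (1 + c) / 2).
  (* Since [c < c2 < 1], the sets [cos t > c] and [cos t < c2], where [a] and [b] are positive,
     cover the circle; normalizing by [a + b] gives the cutoff and its complement [eta], and [eta]
     lives where [q] contracts. *)
  set (a := fun t => flat 0 (1 * (cos t - c))). set (b := fun t => flat 0 ((-1) * (cos t - c2))).
  assert (a0 : forall t, 0 <= a t).
  { intros t. unfold a, flat. destruct (Rlt_dec _ _); [|lra]. simpl. pose proof (exp_pos (- / (1 * (cos t - c)))); lra. }
  assert (b0 : forall t, 0 <= b t).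
  { intros t. unfold b, flat. destruct (Rlt_dec _ _); [|lra]. simpl. pose proof (exp_pos (- / ((-1) * (cos t - c2)))); lra. }
  assert (ab : forall t, a t + b t <> 0).
  { intros t. specialize (a0 t); specialize (b0 t). destruct (Rle_lt_dec (cos t) c) as [H|H].
    - assert (0 < b t); [|lra]. unfold b. rewrite flat_pos by (unfold c2; lra). simpl.
      pose proof (exp_pos (- / ((-1) * (cos t - c2)))); lra.
    - assert (0 < a t); [|lra]. unfold a. rewrite flat_pos by lra. simpl.
      pose proof (exp_pos (- / (1 * (cos t - c)))); lra. }
  assert (Sa : smooth (fun t => RtoC (a t))) by apply smooth_cos_bump.
  assert (Sb : smooth (fun t => RtoC (b t))) by apply smooth_cos_bump.
  assert (Si : smooth (fun t => RtoC (/ (a t + b t)))).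
  { split.
    - intros t. f_equal. f_equal. generalize (proj1 Sa t) (proj1 Sb t). intros E1 E2.
      apply (f_equal fst) in E1, E2. simpl in E1, E2. now rewrite E1, E2.
    - intros n. apply smooth_to_inv; [exact ab|].
      pose proof (smooth_plus _ _ Sa Sb) as S.
      apply (smooth_ext _ (fun t => RtoC (a t + b t))) in S; [apply S|]. intros; now rewrite RtoC_plus. }
  destruct (tpoly_contracting c2) as [l0 [rho [Hrho Hl0]]]; [unfold c2; lra|].
  set (q := fun t => (1 + tpoly l0 t)%C).
  assert (Q : smooth q) by (apply (smooth_plus (fun _ => RtoC 1)); [apply smooth_const|apply smooth_tpoly]).
  set (eta := fun t => (RtoC (b t) * RtoC (/ (a t + b t)))%C).
  assert (Se : smooth eta) by now apply smooth_mult.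
  destruct (bounded_to_pow 3 q c2 rho Q ltac:(lra) Hl0 ((1 + rho) / 2) eta) as [A [A0 HA]]; [lra|exact Se| |].
  { intros t Ht. unfold eta, b. rewrite flat_neg by lra. ring. }
  destruct (pow_lt_1_zero ((1 + rho) / 2)) with (y := eps / (A + 1)) as [N HN];
    [rewrite Rabs_pos_eq; lra|apply Rdiv_lt_0_compat; lra|].
  specialize (HN N (le_n N)). specialize (HA N).
  destruct (tpoly_pow l0 N) as [l Hl].
  (* [F] and [r] are the two parts of the same power [q ^ N], kept near 1 and discarded away from
     it. *)
  exists l, (fun t => (RtoC (a t) * RtoC (/ (a t + b t)) * q t ^ N)%C), (fun t => (eta t * q t ^ N)%C).
  split; [|split; [|split; [|split]]].
  - apply smooth_mult; [now apply smooth_mult|now apply smooth_pow].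
  - apply smooth_mult; [exact Se|now apply smooth_pow].
  - intros t Ht. unfold a at 1. rewrite flat_neg by lra. ring.
  - intros t. assert (E : (RtoC (a t) * RtoC (/ (a t + b t)) + eta t = 1)%C).
    { unfold eta. rewrite <- !RtoC_mult, <- RtoC_plus. f_equal. field. apply ab. }
    replace (RtoC (a t) * RtoC (/ (a t + b t)) * q t ^ N)%C
      with ((RtoC (a t) * RtoC (/ (a t + b t)) + eta t) * q t ^ N - eta t * q t ^ N)%C by ring.
    rewrite E. unfold q at 1. rewrite Hl. ring.
  - intros j t Hj. eapply Rle_trans; [now apply HA|].
    rewrite Rabs_pos_eq in HN by (apply pow_le; lra).
    apply Rlt_div_r in HN; [|lra]. pose proof (pow_lt ((1 + rho) / 2) N ltac:(lra)). nra.
Qed.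

(** * One multiplication step *)

Lemma choose_fun {A B : Type} (P : A -> B -> Prop) : (forall a, exists b, P a b) -> exists f, forall a, P a (f a).
Proof.
  intros H. exists (fun a => proj1_sig (constructive_indefinite_description _ (H a))).
  intros a. apply proj2_sig.
Qed.

Lemma Cmod_eit_minus x y : Cmod (eit x - eit y) ^ 2 = 2 - 2 * cos (x - y).
Proof.
  rewrite Cmod2_alt, cos_minus. unfold eit, Re, Im; simpl.
  pose proof (sin2_cos2 x); pose proof (sin2_cos2 y). unfold Rsqr in *. nra.
Qed.

Lemma sin_le_abs x : 0 <= x -> Rabs (sin x) <= x.
Proof.
  intros Hx. destruct (Req_dec x 0) as [->|H0]; [rewrite sin_0, Rabs_R0; lra|].
  apply Rabs_le. pose proof (sin_lt_x x ltac:(lra)).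
  split; [|lra]. destruct (Rle_lt_dec x PI); [pose proof (sin_ge_0 x Hx r); lra|].
  pose proof PI2_3_2. pose proof (SIN_bound x). unfold PI2 in *; lra.
Qed.

(** Comparing cosines avoids choosing a representative of [x - y] modulo [2 * PI]. *)
Lemma chord_le x y d : 0 <= d -> cos d <= cos (x - y) -> Cmod (eit x - eit y) <= d.
Proof.
  intros Hd H. apply Rsqr_incr_0_var; [|exact Hd]. rewrite !Rsqr_pow2, Cmod_eit_minus.
  assert (E : cos d = 1 - 2 * sin (d / 2) * sin (d / 2)).
  { replace d with (2 * (d / 2)) at 1 by field. apply cos_2a_sin. }
  pose proof (sin_le_abs (d / 2) ltac:(lra)) as S. apply Rabs_le_between in S. nra.
Qed.

Lemma chord_le_arc x y : Cmod (eit x - eit y) <= Rabs (x - y).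
Proof.
  apply chord_le; [apply Rabs_pos|]. unfold Rabs; destruct (Rcase_abs _); [rewrite cos_neg|]; lra.
Qed.

Fixpoint csum (f : nat -> C) (n : nat) : C :=
  match n with O => RtoC 0 | S n => (csum f n + f n)%C end.

Lemma csum_ext f g n : (forall i, (i < n)%nat -> f i = g i) -> csum f n = csum g n.
Proof.
  induction n as [|n IH]; intros H; [reflexivity|]. simpl. rewrite H, IH; auto.
Qed.

Lemma csum_scal c f n : csum (fun i => (c * f i)%C) n = (c * csum f n)%C.
Proof. induction n as [|n IH]; simpl; [ring|]. rewrite IH; ring. Qed.

Lemma csum_minus f g n : csum (fun i => (f i - g i)%C) n = (csum f n - csum g n)%C.
Proof. induction n as [|n IH]; simpl; [ring|]. rewrite IH; ring. Qed.

Lemma csum_nonzero f n : csum f n <> RtoC 0 -> exists i, (i < n)%nat /\ f i <> RtoC 0.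
Proof.
  intros H. apply NNPP; intros K. apply H. rewrite (csum_ext _ (fun _ => 0 * 0)%C).
  - rewrite csum_scal; ring.
  - intros i Hi. transitivity (RtoC 0); [|ring]. apply NNPP; intros Hf. apply K. eauto.
Qed.

Lemma csum_bound f n B : (forall i, (i < n)%nat -> Cmod (f i) <= B) -> Cmod (csum f n) <= INR n * B.
Proof.
  induction n as [|n IH]; intros H; [simpl; rewrite Cmod_0; lra|].
  rewrite S_INR. simpl csum. eapply Rle_trans; [apply Cmod_triangle|].
  specialize (IH (fun i Hi => H i (Nat.lt_lt_succ_r _ _ Hi))). specialize (H n (Nat.lt_succ_diag_r n)). lra.
Qed.

Lemma smooth_csum (f : nat -> R -> C) n : (forall i, smooth (f i)) -> smooth (fun t => csum (fun i => f i t) n).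
Proof.
  intros H; induction n as [|n IH]; [exact (smooth_const (RtoC 0))|].
  apply (smooth_plus (fun t => csum (fun i => f i t) n)); auto.
Qed.

Lemma clinear_csum L (f : nat -> R -> C) n : clinear L -> (forall i, smooth (f i)) ->
  L (fun t => csum (fun i => f i t) n) = csum (fun i => L (f i)) n.
Proof.
  intros H F; induction n as [|n IH]; [now apply clinear_0|].
  cbn [csum]. rewrite clinear_plus; auto using smooth_csum. now rewrite IH.
Qed.

(** An angle in [[0, 2 * PI]] times [q] is at most [8 * q], as [PI <= 4]; hence [8 * q + 1] grid
    points, which may wrap around the circle and overlap. *)
Lemma near_grid q t : (1 <= q)%nat ->
  exists r k, (r < 8 * q + 1)%nat /\ Rabs (t + 2 * IZR k * PI - INR r / INR q) <= 1 / INR q.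
Proof.
  intros Hq. destruct (period_reduce t) as [k Hk]. set (s := t + 2 * IZR k * PI) in *.
  assert (q1 : 1 <= INR q) by (change 1 with (INR 1); now apply le_INR).
  destruct (nfloor_ex (s * INR q)) as [r Hr]; [nra|].
  exists r, k. split.
  - apply INR_lt. rewrite plus_INR, mult_INR. simpl INR. pose proof PI_4. nra.
  - fold s. replace (s - INR r / INR q) with ((s * INR q - INR r) / INR q) by (field; lra).
    unfold Rdiv. rewrite Rabs_mult, (Rabs_pos_eq (/ INR q)) by (left; apply Rinv_0_lt_compat; lra).
    apply Rmult_le_compat_r; [left; apply Rinv_0_lt_compat; lra|]. apply Rabs_le; lra.
Qed.

(** Bumps of radius [2 / q] about grid points: every point lies within [1 / q] of one of them, so
    the sum is positive and can be normalized. *)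
Lemma partition_of_unity q : (1 <= q)%nat -> exists chi : nat -> R -> C,
  (forall r, smooth (chi r)) /\
  (forall t, csum (fun r => chi r t) (8 * q + 1) = RtoC 1) /\
  (forall r t, chi r t <> RtoC 0 -> Cmod (eit t - eit (INR r / INR q)) <= 2 / INR q).
Proof.
  intros Hq. assert (q1 : 1 <= INR q) by (change 1 with (INR 1); now apply le_INR).
  assert (iq : 0 < / INR q <= 1).
  { split; [apply Rinv_0_lt_compat; lra|]. rewrite <- Rinv_1. apply Rinv_le_contravar; lra. }
  set (b := fun r t => flat 0 (1 * (cos (IZR 1 * t + - (INR r / INR q)) - cos (2 / INR q)))).
  assert (Sb : forall r, smooth (fun t => RtoC (b r t))).
  { intros r. apply (smooth_affine (fun t => RtoC (flat 0 (1 * (cos t - cos (2 / INR q)))))).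
    apply smooth_cos_bump. }
  assert (b0 : forall r t, 0 <= b r t).
  { intros r t. unfold b, flat. destruct (Rlt_dec _ _); [|lra]. rewrite pow_O, Rmult_1_l. left; apply exp_pos. }
  set (B := fun t => fst (csum (fun r => RtoC (b r t)) (8 * q + 1))).
  assert (EB : forall n t, csum (fun r => RtoC (b r t)) n = RtoC (fst (csum (fun r => RtoC (b r t)) n))
     /\ 0 <= fst (csum (fun r => RtoC (b r t)) n)
     /\ forall r, (r < n)%nat -> b r t <= fst (csum (fun r => RtoC (b r t)) n)).
  { intros n t. induction n as [|n [E1 [E2 E3]]]; [simpl; split; [reflexivity|split; [lra|intros; lia]]|].
    cbn [csum]. rewrite E1, <- RtoC_plus. specialize (b0 n t) as Hb. simpl fst. split; [reflexivity|split; [lra|]].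
    intros r Hr. destruct (Nat.eq_dec r n) as [->|Hn]; [lra|]. specialize (E3 r ltac:(lia)). lra. }
  assert (Bpos : forall t, B t <> 0).
  { intros t. destruct (near_grid q t Hq) as [r [k [Hr Hrt]]].
    destruct (EB (8 * q + 1)%nat t) as [_ [_ E3]]. specialize (E3 r Hr). fold (B t) in E3.
    assert (0 < b r t); [|lra]. unfold b. rewrite flat_pos.
    - rewrite pow_O, Rmult_1_l. apply exp_pos.
    - rewrite !Rmult_1_l. apply Rlt_0_minus.
      replace (cos (t + - (INR r / INR q))) with (cos (Rabs (t + 2 * IZR k * PI - INR r / INR q))).
      + pose proof (Rabs_pos (t + 2 * IZR k * PI - INR r / INR q)). pose proof PI2_3_2. unfold PI2 in *.
        unfold Rdiv in *. apply cos_decreasing_1; lra.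
      + pose proof (periodic_Z eit eit_period k (t + - (INR r / INR q))) as P.
        apply (f_equal fst) in P. simpl in P. rewrite <- P.
        unfold Rabs; destruct (Rcase_abs _); [rewrite cos_neg|]; f_equal; ring. }
  assert (SB : smooth (fun t => RtoC (B t))).
  { apply (smooth_ext (fun t => csum (fun r => RtoC (b r t)) (8 * q + 1))); [intros; apply EB|].
    now apply (smooth_csum (fun r t => RtoC (b r t))). }
  assert (Si : smooth (fun t => RtoC (/ B t))).
  { split; [|intros; now apply smooth_to_inv; [|apply SB]].
    intros t. pose proof (proj1 SB t) as P. apply (f_equal fst) in P. simpl in P. now rewrite P. }
  exists (fun r t => (RtoC (/ B t) * RtoC (b r t))%C). split; [|split].
  - intros r. now apply smooth_mult.
  - intros t. rewrite csum_scal. rewrite (proj1 (EB _ t)). fold (B t). rewrite <- RtoC_mult. f_equal. field. apply Bpos.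
  - intros r t H. apply chord_le; [unfold Rdiv; lra|].
    apply Rnot_lt_le; intros Hlt. apply H. unfold b. rewrite flat_neg; [ring|]. unfold Rminus in Hlt. rewrite !Rmult_1_l. lra.
Qed.

Lemma localized_step L c eps : pseudofunction L -> c < 1 -> 0 < eps ->
  exists F (n0 : nat), smooth F /\ (forall t, cos t <= c -> F t = RtoC 0) /\
  forall (n : nat) v (m : Z), (n0 <= n)%nat ->
    let d := L (fun t => ((F (IZR (Z.of_nat n) * t + v)%R - 1) * e (- m) t)%C) in
    ((m <= 0)%Z -> Cmod d <= eps) /\ Cmod d <= eps * (1 + Rabs (IZR m)).
Proof.
  intros HL Hc He. destruct (pseudofunction_bounded L HL) as [B [B0 HB]].
  destruct (localizer c (eps / (40 * B)) Hc) as [l [F [r [SF [Sr [HF [E Hr]]]]]]];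
    [apply Rdiv_lt_0_compat; lra|].
  destruct (perturb_small L B l r HL HB eps He Sr Hr B0) as [n0 H0].
  exists F, n0. split; [exact SF|split; [exact HF|]]. intros n v m Hn d.
  specialize (H0 n v m Hn). cbv zeta in H0.
  assert (Ed : d = L (fun t => ((tpoly l (IZR (Z.of_nat n) * t + v) - r (IZR (Z.of_nat n) * t + v)%R) * e (- m) t)%C))
    by (apply clinear_ext; intros; now rewrite E).
  now rewrite Ed.
Qed.

Lemma nat_upper_bound (f : nat -> nat) n : exists N, forall i, (i < n)%nat -> (f i <= N)%nat.
Proof.
  induction n as [|n [N HN]]; [exists O; lia|]. exists (N + f n)%nat. intros i Hi.
  destruct (Nat.eq_dec i n) as [->|H]; [lia|]. specialize (HN i ltac:(lia)). lia.
Qed.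

(* The step handling one continuous target [u]: on the arc around [exp(i r/q)] the support is forced
   to satisfy [z^n ~ exp(i sigma(r)/q)]. *)
Lemma step L g q (sigma : nat -> nat) eps : pseudofunction L -> smooth g -> (1 <= q)%nat -> 0 < eps ->
  exists h (n : nat), smooth h /\ (1 <= n)%nat /\
    (forall t, h t <> RtoC 0 -> exists r, (r < 8 * q + 1)%nat /\
       Cmod (eit t - eit (INR r / INR q)) <= 2 / INR q /\
       Cmod (e (Z.of_nat n) t - eit (INR (sigma r) / INR q)) <= 2 / INR q) /\
    forall m, let d := L (fun t => ((g t * h t - g t) * e (- m) t)%C) in
      ((m <= 0)%Z -> Cmod d <= eps) /\ Cmod d <= eps * (1 + Rabs (IZR m)).
Proof.
  intros HL G Hq He. assert (q1 : 1 <= INR q) by (change 1 with (INR 1); now apply le_INR).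
  assert (iq : 0 < / INR q <= 1).
  { split; [apply Rinv_0_lt_compat; lra|]. rewrite <- Rinv_1. apply Rinv_le_contravar; lra. }
  destruct (partition_of_unity q Hq) as [chi [Sc [Hc1 Hc2]]].
  assert (cq : cos (2 / INR q) < 1).
  { rewrite <- cos_0. pose proof PI2_3_2. unfold PI2, Rdiv in *. apply cos_decreasing_1; lra. }
  set (K := (8 * q + 1)%nat) in *.
  assert (K0 : 0 < INR K) by (apply lt_0_INR; unfold K; lia).
  (* The errors of the [K] arcs add up. *)
  assert (He' : 0 < eps / INR K) by now apply Rdiv_lt_0_compat.
  assert (St : forall r, exists p : (R -> C) * nat, smooth (fst p) /\
    (forall t, cos t <= cos (2 / INR q) -> fst p t = RtoC 0) /\
    forall (n : nat) v (m : Z), (snd p <= n)%nat ->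
      let d := mulL L (fun t => (g t * chi r t)%C) (fun t => ((fst p (IZR (Z.of_nat n) * t + v)%R - 1) * e (- m) t)%C) in
      ((m <= 0)%Z -> Cmod d <= eps / INR K) /\ Cmod d <= eps / INR K * (1 + Rabs (IZR m))).
  { intros r. destruct (localized_step (mulL L (fun t => (g t * chi r t)%C)) _ _
      (pseudofunction_mulL L _ HL (smooth_mult _ _ G (Sc r))) cq He') as [F [n0 H]].
    now exists (F, n0). }
  destruct (choose_fun _ St) as [p Hp].
  (* The threshold of each arc is independent of the rotation [v], so a single [n] works for all
     arcs together. *)
  destruct (nat_upper_bound (fun r => snd (p r)) K) as [N HN].
  set (n := S N). set (nz := Z.of_nat n).
  set (Fr := fun r t => fst (p r) (IZR nz * t + - (INR (sigma r) / INR q))).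
  assert (SF : forall r, smooth (Fr r)) by (intros r; apply smooth_affine, Hp).
  exists (fun t => csum (fun r => (chi r t * Fr r t)%C) K), n.
  split; [|split; [unfold n; lia|split]].
  - apply (smooth_csum (fun r t => (chi r t * Fr r t)%C)). intros; now apply smooth_mult.
  - intros t Ht. apply csum_nonzero in Ht. destruct Ht as [r [Hr Ht]]. exists r. split; [exact Hr|split].
    + apply Hc2. intros E; apply Ht. rewrite E; ring.
    + apply chord_le; [unfold Rdiv; lra|]. apply Rnot_lt_le; intros Hlt. apply Ht.
      unfold Fr. rewrite (proj1 (proj2 (Hp r))); [ring|]. fold nz in Hlt. unfold Rminus in Hlt. lra.
  - intros m d.
    set (f := fun r t => ((g t * chi r t) * ((Fr r t - 1) * e (- m) t))%C).
    assert (Sf : forall r, smooth (f r)).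
    { intros r. apply smooth_mult; [now apply smooth_mult|]. apply smooth_mult; [|apply smooth_e].
      apply smooth_minus; [apply SF|apply smooth_const]. }
    (* Since the [chi r] sum to 1, [h - 1] is the sum of [chi r * (Fr r - 1)]. *)
    assert (E : d = csum (fun r => L (f r)) K).
    { unfold d. rewrite <- clinear_csum; [|apply HL|exact Sf]. apply clinear_ext. intros t.
      rewrite (csum_ext (fun r => f r t) (fun r => ((g t * e (- m) t) * (chi r t * Fr r t - chi r t))%C))
        by (intros; unfold f; ring).
      rewrite csum_scal, csum_minus, Hc1. ring. }
    assert (EK : eps = INR K * (eps / INR K)) by (field; lra).
    assert (Hf : forall r, (r < K)%nat -> ((m <= 0)%Z -> Cmod (L (f r)) <= eps / INR K) /\
        Cmod (L (f r)) <= eps / INR K * (1 + Rabs (IZR m))).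
    { intros r Hr. apply (proj2 (proj2 (Hp r)) n (- (INR (sigma r) / INR q)) m).
      specialize (HN r Hr). simpl in HN. unfold n; lia. }
    split.
    + intros Hm. rewrite E, EK. apply csum_bound. intros r Hr. now apply Hf.
    + rewrite E, EK, Rmult_assoc. apply csum_bound. intros r Hr. now apply Hf.
Qed.

(** A finite choice of grid values is coded by one natural number, which makes the step functions
    countable. *)
Lemma digits_exist b (s : nat -> nat) n : (forall i, (s i < b)%nat) ->
  exists N, forall i, (i < n)%nat -> ((N / b ^ i) mod b = s i)%nat.
Proof.
  intros H. revert s H; induction n as [|n IH]; intros s H; [exists O; lia|].
  destruct (IH (fun i => s (S i))) as [N HN]; [auto|].
  assert (b0 : (b <> 0)%nat) by (specialize (H O); lia).
  exists (s O + N * b)%nat. intros [|i] Hi.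
  - rewrite Nat.pow_0_r, Nat.div_1_r, Nat.Div0.mod_add. apply Nat.mod_small, H.
  - rewrite Nat.pow_succ_r', <- Nat.Div0.div_div, Nat.div_add, (Nat.div_small (s O)) by auto.
    apply HN; lia.
Qed.

(** * Limits, supports and Kronecker sets *)

Definition conv (u : nat -> C) (l : C) : Prop :=
  forall eps, 0 < eps -> exists N : nat, forall n, (N <= n)%nat -> Cmod (u n - l) < eps.

(** Built on the total [Lim_seq], so it is defined for every sequence; it is meaningful only
    together with a convergence proof such as [geometric_limit]. *)
Definition clim (u : nat -> C) : C :=
  (real (Lim_seq (fun n => fst (u n))), real (Lim_seq (fun n => snd (u n)))).

Lemma Cmod_small_eq (z w : C) : (forall eps, 0 < eps -> Cmod (z - w) < eps) -> z = w.
Proof.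
  intros H. assert (E : (z - w)%C = RtoC 0).
  { apply Cmod_eq_0. apply Rle_antisym; [|apply Cmod_ge_0]. apply Rnot_lt_le; intros K.
    specialize (H _ K). lra. }
  replace z with ((z - w) + w)%C by ring. rewrite E; ring.
Qed.

Lemma conv_unique u l l' : conv u l -> conv u l' -> l = l'.
Proof.
  intros H H'. apply Cmod_small_eq. intros eps He.
  destruct (H (eps / 2)) as [N HN]; [lra|]. destruct (H' (eps / 2)) as [N' HN']; [lra|].
  specialize (HN (N + N')%nat ltac:(lia)). specialize (HN' (N + N')%nat ltac:(lia)).
  pose proof (Cmod_triangle_mid l (u (N + N')%nat) l') as T.
  rewrite (Cmod_minus_sym l (u _)) in T. lra.
Qed.

Lemma conv_lin u v l k a b : conv u l -> conv v k -> conv (fun n => (a * u n + b * v n)%C) (a * l + b * k)%C.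
Proof.
  intros H H' eps He. pose proof (Cmod_ge_0 a) as Ha. pose proof (Cmod_ge_0 b) as Hb.
  destruct (H (eps / (2 * (Cmod a + 1)))) as [N HN]; [apply Rdiv_lt_0_compat; lra|].
  destruct (H' (eps / (2 * (Cmod b + 1)))) as [N' HN']; [apply Rdiv_lt_0_compat; lra|].
  exists (N + N')%nat. intros n Hn. specialize (HN n ltac:(lia)). specialize (HN' n ltac:(lia)).
  replace (a * u n + b * v n - (a * l + b * k))%C with (a * (u n - l) + b * (v n - k))%C by ring.
  eapply Rle_lt_trans; [apply Cmod_triangle|]. rewrite !Cmod_mult.
  apply Rlt_div_r in HN; [|lra]. apply Rlt_div_r in HN'; [|lra].
  pose proof (Cmod_ge_0 (u n - l)). pose proof (Cmod_ge_0 (v n - k)). nra.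
Qed.

Lemma real_geometric_limit (u : nat -> R) A : (forall j, Rabs (u (S j) - u j) <= A * (/ 2) ^ j) ->
  is_lim_seq u (real (Lim_seq u)) /\ forall j, Rabs (real (Lim_seq u) - u j) <= 2 * A * (/ 2) ^ j.
Proof.
  intros H.
  assert (A0 : 0 <= A) by (specialize (H O); pose proof (Rabs_pos (u 1%nat - u O)); simpl in H; lra).
  assert (hp : forall j, 0 < (/ 2) ^ j) by (intros; apply pow_lt; lra).
  assert (T : forall j n, (j <= n)%nat -> Rabs (u n - u j) <= 2 * A * ((/ 2) ^ j - (/ 2) ^ n)).
  { intros j n Hn. induction Hn as [|n Hn IH]; [rewrite !Rminus_diag, Rabs_R0; lra|].
    replace (u (S n) - u j) with ((u (S n) - u n) + (u n - u j)) by ring.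
    eapply Rle_trans; [apply Rabs_triang|]. specialize (H n). simpl pow. lra. }
  assert (C : ex_lim_seq_cauchy u).
  { intros eps. destruct (pow_lt_1_zero (/ 2)) with (y := eps / (4 * (A + 1))) as [N HN].
    - rewrite Rabs_pos_eq; lra.
    - apply Rdiv_lt_0_compat; [apply cond_pos|lra].
    - exists N. intros n m Hn Hm. specialize (HN N (le_n N)). rewrite Rabs_pos_eq in HN by (left; apply hp).
      apply Rlt_div_r in HN; [|lra].
      pose proof (T N n Hn) as T1. pose proof (T N m Hm) as T2.
      replace (u n - u m) with ((u n - u N) - (u m - u N)) by ring.
      unfold Rminus at 1. eapply Rle_lt_trans; [apply Rabs_triang|]. rewrite Rabs_Ropp.
      pose proof (hp n); pose proof (hp m); pose proof (hp N). nra. }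
  apply ex_lim_seq_cauchy_corr in C. apply Lim_seq_correct' in C. split; [exact C|].
  intros j. assert (L : is_lim_seq (fun n => Rabs (u n - u j)) (Rabs (real (Lim_seq u) - u j))).
  { apply (is_lim_seq_abs _ (Finite (real (Lim_seq u) - u j))).
    apply is_lim_seq_minus'; [exact C|apply is_lim_seq_const]. }
  refine (is_lim_seq_le_loc _ (fun _ => 2 * A * (/ 2) ^ j) (Finite _) (Finite _) _ L (is_lim_seq_const _)).
  exists j. intros n Hn. specialize (T j n Hn). pose proof (hp n). nra.
Qed.

(** The 4 is the sum 2 of the geometric tail, once for each of the two components. *)
Lemma geometric_limit u A : (forall j, Cmod (u (S j) - u j) <= A * (/ 2) ^ j) ->
  conv u (clim u) /\ forall j, Cmod (clim u - u j) <= 4 * A * (/ 2) ^ j.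
Proof.
  intros H.
  destruct (real_geometric_limit (fun n => fst (u n)) A) as [L1 B1].
  { intros j. eapply Rle_trans; [apply (abs_fst_le (u (S j) - u j))|apply H]. }
  destruct (real_geometric_limit (fun n => snd (u n)) A) as [L2 B2].
  { intros j. eapply Rle_trans; [apply (abs_snd_le (u (S j) - u j))|apply H]. }
  assert (B : forall j, Cmod (clim u - u j) <= 4 * A * (/ 2) ^ j).
  { intros j. eapply Rle_trans; [apply Cmod_le_abs|]. specialize (B1 j); specialize (B2 j).
    unfold clim; simpl in *. unfold Rminus in *. lra. }
  split; [|exact B]. intros eps He.
  assert (A0 : 0 <= A) by (specialize (H O); pose proof (Cmod_ge_0 (u 1%nat - u O)); simpl in H; lra).
  destruct (pow_lt_1_zero (/ 2)) with (y := eps / (4 * (A + 1))) as [N HN];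
    [rewrite Rabs_pos_eq; lra|apply Rdiv_lt_0_compat; lra|].
  exists N. intros n Hn. specialize (HN n Hn).
  assert (0 < (/ 2) ^ n) by (apply pow_lt; lra). rewrite Rabs_pos_eq in HN by lra.
  apply Rlt_div_r in HN; [|lra]. rewrite Cmod_minus_sym. specialize (B n). nra.
Qed.

(** * Real and complex test functions *)

Lemma Dn_RtoC (f : R -> R) j : Dn j (fun t => RtoC (f t)) = fun t => RtoC (Derive_n f j t).
Proof.
  induction j as [|j IH]; [reflexivity|]. rewrite Dn_out, IH.
  apply functional_extensionality; intros t. apply injective_projections; [reflexivity|].
  simpl. apply Derive_const.
Qed.

Lemma smooth_to_of_Dn n f : (forall j t, has_deriv (Dn j f) t (D (Dn j f) t)) -> smooth_to n f.
Proof.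
  revert f; induction n as [|n IH]; intros f H; [exact I|]. split; [apply (H O)|].
  apply IH. intros j. apply (H (S j)).
Qed.

Lemma test_fun_smooth phi : test_fun phi -> smooth (fun t => RtoC (phi t)).
Proof.
  intros [P H]. split; [intros; now rewrite P|]. intros n. apply smooth_to_of_Dn. intros j t.
  rewrite <- Dn_out, !Dn_RtoC. apply has_deriv_real. simpl. apply Derive_correct. apply (H (S j) t).
Qed.

Lemma Derive_n_fst f j : Derive_n (fun t => fst (f t)) j = fun t => fst (Dn j f t).
Proof.
  induction j as [|j IH]; [reflexivity|]. rewrite Dn_out. simpl Derive_n. now rewrite IH.
Qed.

Lemma Derive_n_snd f j : Derive_n (fun t => snd (f t)) j = fun t => snd (Dn j f t).
Proof.
  induction j as [|j IH]; [reflexivity|]. rewrite Dn_out. simpl Derive_n. now rewrite IH.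
Qed.

Lemma smooth_test_fun f : smooth f -> test_fun (fun t => fst (f t)) /\ test_fun (fun t => snd (f t)).
Proof.
  intros H. split; (split; [intros; now rewrite (proj1 H)|intros [|k] t; [exact I|]]); simpl.
  - rewrite Derive_n_fst. exists (fst (D (Dn k f) t)).
    apply (smooth_has_deriv (Dn k f) t (smooth_Dn k f H)).
  - rewrite Derive_n_snd. exists (snd (D (Dn k f) t)).
    apply (smooth_has_deriv (Dn k f) t (smooth_Dn k f H)).
Qed.

Definition complexify (S : (R -> R) -> C) (f : R -> C) : C :=
  (S (fun t => fst (f t)) + Ci * S (fun t => snd (f t)))%C.

Lemma cdist_complexify S : is_distribution S -> cdist (complexify S).
Proof.
  intros [Lin [K [k HK]]]. split.
  - intros f g a b F G.
    destruct (smooth_test_fun f F) as [F1 F2]. destruct (smooth_test_fun g G) as [G1 G2].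
    destruct (smooth_test_fun _ (smooth_scal a f F)) as [A1 A2]. destruct (smooth_test_fun _ (smooth_scal b g G)) as [B1 B2].
    assert (Add : forall p q, test_fun p -> test_fun q -> S (fun t => p t + q t) = (S p + S q)%C).
    { intros p q Hp Hq. transitivity (S (fun t => 1 * p t + 1 * q t)).
      - f_equal. apply functional_extensionality; intros; ring.
      - rewrite Lin by assumption. ring. }
    unfold complexify. cbn [fst snd Cplus Cmult] in *.
    rewrite (Add _ _ A1 B1), (Add _ _ A2 B2).
    assert (E1 : forall c p q, test_fun p -> test_fun q ->
      (S (fun t => fst c * p t - snd c * q t)%R + Ci * S (fun t => fst c * q t + snd c * p t)%R
        = c * (S p + Ci * S q))%C).
    { intros c p q Hp Hq. rewrite Lin by assumption.
      replace (fun t => fst c * p t - snd c * q t) with (fun t => fst c * p t + (- snd c) * q t)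
        by (apply functional_extensionality; intros; ring).
      rewrite Lin by assumption. generalize (S p) (S q). intros [p1 p2] [q1 q2]. destruct c as [c1 c2].
      apply injective_projections; simpl; ring. }
    rewrite <- (E1 a _ _ F1 F2), <- (E1 b _ _ G1 G2). ring.
  - exists (2 * Rabs K), k. split; [pose proof (Rabs_pos K); lra|]. intros f M F HM.
    assert (M0 := bounded_to_nonneg _ _ _ HM).
    destruct (smooth_test_fun f F) as [F1 F2].
    assert (K1 : K * M <= Rabs K * M) by (apply Rmult_le_compat_r; [exact M0|apply Rle_abs]).
    unfold complexify. eapply Rle_trans; [apply Cmod_triangle|]. rewrite Cmod_mult, Cmod_Ci, Rmult_1_l.
    assert (Cmod (S (fun t => fst (f t))) <= K * M).
    { apply HK; [exact F1|]. intros j t Hj. rewrite Derive_n_fst. eapply Rle_trans; [apply abs_fst_le|now apply HM]. }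
    assert (Cmod (S (fun t => snd (f t))) <= K * M).
    { apply HK; [exact F2|]. intros j t Hj. rewrite Derive_n_snd. eapply Rle_trans; [apply abs_snd_le|now apply HM]. }
    lra.
Qed.

Lemma complexify_e S m : is_distribution S -> complexify S (e (- m)) = fourier S m.
Proof.
  intros HS. destruct HS as [Lin _].
  destruct (smooth_test_fun (e (- m)) (smooth_e (- m))) as [_ T]. simpl in T.
  destruct (smooth_test_fun (e m) (smooth_e m)) as [_ T']. simpl in T'.
  unfold complexify, fourier. unfold Cminus. f_equal.
  - f_equal. apply functional_extensionality; intros t. simpl. rewrite opp_IZR.
    replace (- IZR m * t) with (- (IZR m * t)) by ring. apply cos_neg.
  - replace (fun t => snd (e (- m) t)) with (fun t => (-1) * sin (IZR m * t) + 0 * sin (IZR m * t)).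
    + rewrite Lin by exact T'. ring.
    + apply functional_extensionality; intros t. simpl. rewrite opp_IZR.
      replace (- IZR m * t) with (- (IZR m * t)) by ring. rewrite sin_neg. ring.
Qed.

Lemma on_circle_eit z : on_circle z -> exists x, 0 <= x <= 2 * PI /\ z = eit x.
Proof.
  intros H. unfold on_circle in H.
  assert (E : fst z ^ 2 + snd z ^ 2 = 1) by (pose proof (Cmod2_alt z) as E; rewrite H in E; unfold Re, Im in E; lra).
  assert (X : exists x, z = eit x).
  { assert (B : -1 <= fst z <= 1) by nra.
    assert (Q : sqrt (1 - Rsqr (fst z)) = Rabs (snd z)).
    { rewrite <- sqrt_Rsqr_abs. f_equal. unfold Rsqr. lra. }
    destruct (Rle_lt_dec 0 (snd z)).
    - exists (acos (fst z)). apply injective_projections; simpl; [now rewrite cos_acos|].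
      now rewrite sin_acos, Q, Rabs_pos_eq.
    - exists (- acos (fst z)). apply injective_projections; simpl; [now rewrite cos_neg, cos_acos|].
      rewrite sin_neg, sin_acos, Q, Rabs_left by assumption. ring. }
  destruct X as [x ->]. destruct (period_reduce x) as [k Hk]. exists (x + 2 * IZR k * PI).
  split; [exact Hk|]. symmetry. apply periodic_Z, eit_period.
Qed.

Lemma Zpow_eit (n : nat) x : Zpow (eit x) (Z.of_nat n) = e (Z.of_nat n) x.
Proof.
  assert (P : forall k, Cpow (eit x) k = eit (INR k * x)).
  { induction k as [|k IH]; [simpl; now rewrite Rmult_0_l, eit_0|].
    rewrite Cpow_S, IH, S_INR, <- eit_plus. f_equal; ring. }
  unfold e. rewrite <- INR_IZR_INZ. destruct n as [|n].
  - simpl. now rewrite Rmult_0_l, eit_0.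
  - change (Cpow (eit x) (Pos.to_nat (Pos.of_succ_nat n)) = eit (INR (S n) * x)).
    rewrite SuccNat2Pos.id_succ. apply P.
Qed.

Lemma closed_supp S : closed_subset_circle (supp S).
Proof.
  split; [|now intros z []].
  change (forall z : C, ~ locally (T := C_UniformSpace) z (fun w : C => ~ supp S w) -> supp S z).
  intros z Hz.
  assert (Near : forall eps, 0 < eps -> exists w, Cmod (w - z) < eps /\ supp S w).
  { intros eps He. apply NNPP; intros K. apply Hz.
    (* Uniform balls of C compare with [Cmod] discs up to a factor [sqrt 2 < 2], hence the halved
       radius. *)
    assert (He2 : 0 < eps / 2) by lra. exists (mkposreal _ He2). intros w Hw Sw. apply K. exists w. split; [|exact Sw].
    apply C_NormedModule_mixin_compat2 in Hw. simpl in Hw. change (minus w z) with (w - z)%C in Hw.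
    assert (sqrt 2 < 2).
    { rewrite <- (sqrt_pow2 2) at 2 by lra. apply sqrt_lt_1_alt; lra. }
    nra. }
  split.
  - unfold on_circle. apply Rle_antisym; apply Rnot_lt_le; intros K.
    + destruct (Near (Cmod z - 1)) as [w [Hw [Cw _]]]; [lra|]. unfold on_circle in Cw.
      pose proof (Cmod_triangle_mid z w 0) as T. rewrite (Cmod_minus_sym z w) in T.
      replace (z - 0)%C with z in T by ring. replace (w - 0)%C with w in T by ring. lra.
    + destruct (Near (1 - Cmod z)) as [w [Hw [Cw _]]]; [lra|]. unfold on_circle in Cw.
      pose proof (Cmod_triangle_mid w z 0) as T.
      replace (z - 0)%C with z in T by ring. replace (w - 0)%C with w in T by ring. lra.
  - intros eps He. destruct (Near (eps / 2)) as [w [Hw [_ Sw]]]; [lra|].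
    destruct (Sw (eps / 2)) as [phi [T [V N]]]; [lra|]. exists phi. split; [exact T|split; [|exact N]].
    intros t Ht. apply V. pose proof (Cmod_triangle_mid (eit t) w z). lra.
Qed.

(* Heine's theorem for [u] on a closed subset of the circle, by compactness of the interval of angles. *)
Lemma uniform_oscillation K (u : C -> C) : closed_subset_circle K ->
  (forall z, K z -> forall eps : R, 0 < eps -> exists delta : R, 0 < delta /\
     forall w, K w -> Cmod (w - z) < delta -> Cmod (u w - u z) < eps) ->
  forall eps a, 0 < eps -> exists d, 0 < d /\ forall x w w', 0 <= x <= a ->
    K w -> K w' -> Cmod (w - eit x) < d -> Cmod (w' - eit x) < d -> Cmod (u w - u w') < eps.
Proof.
  intros [Kc _] Hu eps a He.
  assert (Loc : forall x, exists d : posreal, forall w w', K w -> K w' ->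
     Cmod (w - eit x) < 2 * d -> Cmod (w' - eit x) < 2 * d -> Cmod (u w - u w') < eps).
  { intros x. destruct (classic (K (eit x))) as [Hk|Hk].
    - destruct (Hu _ Hk (eps / 2)) as [d [Hd H]]; [lra|].
      assert (Hd2 : 0 < d / 2) by lra. exists (mkposreal _ Hd2). simpl. intros w w' W W' H1 H2.
      specialize (H w W ltac:(lra)) as E1. specialize (H w' W' ltac:(lra)) as E2.
      pose proof (Cmod_triangle_mid (u w) (u (eit x)) (u w')) as T.
      rewrite (Cmod_minus_sym (u (eit x)) (u w')) in T. lra.
    (* The centre [eit x] need not lie in [K]; when it does not, closedness provides a radius within
       which [K] has no point. *)
    - apply NNPP; intros Hn. apply Hk, Kc. intros [d Hd].
      assert (Hd2 : 0 < d / 2) by (pose proof (cond_pos d); lra). apply Hn. exists (mkposreal _ Hd2). simpl.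
      intros w w' W W' H1 H2. exfalso. apply (Hd w); [|exact W].
      apply C_NormedModule_mixin_compat1. change (Cmod (w - eit x) < d). lra. }
  destruct (choose_fun _ Loc) as [delta Hdelta].
  destruct (compactness_value_1d 0 a delta) as [d Hd].
  exists d. split; [apply cond_pos|]. intros x w w' Hx W W' H1 H2.
  specialize (Hd x Hx). apply NNPP in Hd. destruct Hd as [t [Ht [Hxt Hdt]]].
  pose proof (chord_le_arc x t) as Ch.
  apply (Hdelta t); auto.
  - pose proof (Cmod_triangle_mid w (eit x) (eit t)). lra.
  - pose proof (Cmod_triangle_mid w' (eit x) (eit t)). lra.
Qed.

(** The successor keeps the scale positive. *)
Definition task_scale (j : nat) : nat := S (fst (Cantor.of_nat j)).

(* The second component of the pair coded by [j] is read in base [8 q + 1], [q = task_scale j]. *)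
Definition task_target (j r : nat) : nat :=
  let b := (8 * task_scale j + 1)%nat in ((snd (Cantor.of_nat j) / b ^ r) mod b)%nat.

Lemma task_exists q (s : nat -> nat) : (1 <= q)%nat -> (forall r, (s r < 8 * q + 1)%nat) ->
  exists j, task_scale j = q /\ forall r, (r < 8 * q + 1)%nat -> task_target j r = s r.
Proof.
  intros Hq Hs. destruct (digits_exist (8 * q + 1) s (8 * q + 1) Hs) as [N HN].
  exists (Cantor.to_nat (pred q, N)).
  assert (E : task_scale (Cantor.to_nat (pred q, N)) = q).
  { unfold task_scale. rewrite Cantor.cancel_of_to. simpl; lia. }
  split; [exact E|]. intros r Hr. unfold task_target. rewrite E, Cantor.cancel_of_to. now apply HN.
Qed.

Lemma supp_circle_angle S z : supp S z -> exists x, 0 <= x <= 2 * PI /\ z = eit x.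
Proof. intros [H _]. now apply on_circle_eit. Qed.

(** At a fine scale [u] is nearly constant on the part of [K] near each grid point, hence close to a
    step function with values on the grid. That step function is one of the tasks, and its exponent
    [n] makes [z^n] follow it. *)
Lemma kronecker_of_tasks K : closed_subset_circle K ->
  (forall j, exists n : nat, forall z, K z -> exists r, (r < 8 * task_scale j + 1)%nat /\
     Cmod (z - eit (INR r / INR (task_scale j))) <= 4 / INR (task_scale j) /\
     Cmod (Zpow z (Z.of_nat n) - eit (INR (task_target j r) / INR (task_scale j))) <= 4 / INR (task_scale j)) ->
  kronecker_set K.
Proof.
  intros Kc HK. split; [exact Kc|]. intros u Hu1 Hu2 eps He.
  (* The grid angles satisfy [r / q < 8 + 1 / q <= 9]. *)
  destruct (uniform_oscillation K u Kc Hu2 (eps / 2) 9) as [d [Hd Hosc]]; [lra|].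
  set (d' := Rmin d (eps / 2)). assert (Hd' : 0 < d') by (apply Rmin_glb_lt; lra).
  (* The final error is [eps / 2] from the oscillation, [1 / q] from rounding the value of [u] and
     [4 / q] from the task. *)
  destruct (nfloor_ex (5 / d')) as [q0 Hq0]; [apply Rdiv_le_0_compat; lra|].
  set (q := S q0).
  assert (q1 : 1 <= INR q) by (change 1 with (INR 1); apply le_INR; unfold q; lia).
  assert (Hq : 5 / INR q < d').
  { destruct Hq0 as [_ Hq0]. apply Rlt_div_l in Hq0; [|exact Hd']. apply Rlt_div_l; [lra|].
    unfold q. rewrite S_INR. lra. }
  assert (dd : d' <= d) by apply Rmin_l. assert (de : d' <= eps / 2) by apply Rmin_r.
  assert (iq : 0 < / INR q) by (apply Rinv_0_lt_compat; lra).
  assert (Sg : forall r, exists s, (s < 8 * q + 1)%nat /\ ((r < 8 * q + 1)%nat ->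
     forall z, K z -> Cmod (z - eit (INR r / INR q)) <= 4 / INR q ->
       Cmod (u z - eit (INR s / INR q)) < eps / 2 + 1 / INR q)).
  { intros r. destruct (classic (exists z0, K z0 /\ Cmod (z0 - eit (INR r / INR q)) <= 4 / INR q)) as [[z0 [K0 H0]]|Hn].
    - destruct (on_circle_eit _ (Hu1 _ K0)) as [x [_ Hx]].
      destruct (near_grid q x ltac:(unfold q; lia)) as [s [k [Hs Hsx]]].
      exists s. split; [exact Hs|]. intros Hr z Kz Hz.
      assert (Osc : Cmod (u z - u z0) < eps / 2).
      { apply (Hosc (INR r / INR q)); auto; try (unfold Rdiv in *; lra).
        split; [unfold Rdiv; apply Rmult_le_pos; [apply pos_INR|lra]|].
        apply Rle_div_l; [lra|]. apply lt_INR in Hr. rewrite plus_INR, mult_INR in Hr. replace (INR 8) with 8 in Hr by (simpl; lra). simpl (INR 1) in Hr. lra. }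
      pose proof (Cmod_triangle_mid (u z) (u z0) (eit (INR s / INR q))) as T.
      rewrite Hx in T at 2. rewrite <- (periodic_Z eit eit_period k x) in T.
      pose proof (chord_le_arc (x + 2 * IZR k * PI) (INR s / INR q)). lra.
    (* With no point of [K] near this grid point, any value will do. *)
    - exists O. split; [lia|]. intros _ z Kz Hz. exfalso. apply Hn. eauto. }
  destruct (choose_fun _ Sg) as [s Hs].
  destruct (task_exists q s ltac:(unfold q; lia) (fun r => proj1 (Hs r))) as [j [Ej Hj]].
  destruct (HK j) as [n Hn]. rewrite Ej in Hn. exists (Z.of_nat n). intros z Kz.
  destruct (Hn z Kz) as [r [Hr [H1 H2]]]. rewrite (Hj r Hr) in H2.
  pose proof (proj2 (Hs r) Hr z Kz H1) as H3.
  pose proof (Cmod_triangle_mid (u z) (eit (INR (s r) / INR q)) (Zpow z (Z.of_nat n))) as T.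
  rewrite (Cmod_minus_sym (eit _)) in T. unfold Rdiv in *. lra.
Qed.

(** * The infinite product *)

Definition meets_task (j n : nat) (t : R) : Prop :=
  exists r, (r < 8 * task_scale j + 1)%nat /\
    Cmod (eit t - eit (INR r / INR (task_scale j))) <= 2 / INR (task_scale j) /\
    Cmod (e (Z.of_nat n) t - eit (INR (task_target j r) / INR (task_scale j))) <= 2 / INR (task_scale j).

(** Each [G (S j)] is [G j] times the factor for task [j]; all later products inherit its zeros, so
    the condition of task [j] persists for every [i > j]. *)
Lemma multiplier_sequence L eta : pseudofunction L -> 0 < eta ->
  exists (G : nat -> R -> C) (n : nat -> nat),
    (forall t, G O t = RtoC 1) /\ (forall j, smooth (G j)) /\
    (forall j i t, (j < i)%nat -> G i t <> RtoC 0 -> meets_task j (n j) t) /\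
    (forall j, (1 <= n j)%nat) /\
    forall j m, let d := L (fun t => ((G (S j) t - G j t) * e (- m) t)%C) in
      ((m <= 0)%Z -> Cmod d <= eta * (/ 2) ^ j) /\ Cmod d <= eta * (/ 2) ^ j * (1 + Rabs (IZR m)).
Proof.
  intros HL Heta.
  (* Smoothness is a premise inside the existential, so that the choice is made once for all pairs,
     before the recursion; a function that is not smooth gets a default. *)
  assert (St : forall a : nat * (R -> C), exists p : (R -> C) * nat, smooth (snd a) ->
    smooth (fst p) /\ (1 <= snd p)%nat /\ (forall t, fst p t <> RtoC 0 -> meets_task (fst a) (snd p) t) /\
    forall m, let d := L (fun t => ((snd a t * fst p t - snd a t) * e (- m) t)%C) in
      ((m <= 0)%Z -> Cmod d <= eta * (/ 2) ^ fst a) /\ Cmod d <= eta * (/ 2) ^ fst a * (1 + Rabs (IZR m))).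
  { intros [j g]. destruct (classic (smooth g)) as [G|G].
    - destruct (step L g (task_scale j) (task_target j) (eta * (/ 2) ^ j) HL G) as [h [n H]].
      + unfold task_scale; lia.
      + apply Rmult_lt_0_compat; [exact Heta|apply pow_lt; lra].
      + now exists (h, n).
    - now exists (g, O). }
  destruct (choose_fun _ St) as [p Hp].
  set (G := fix G (j : nat) : R -> C := match j with
    | O => fun _ => RtoC 1 | S j => fun t => (G j t * fst (p (j, G j)) t)%C end).
  assert (SG : forall j, smooth (G j)).
  { induction j as [|j IH]; [exact (smooth_const (RtoC 1))|].
    apply (smooth_mult (G j)); [exact IH|]. now apply (Hp (j, G j)). }
  exists G, (fun j => snd (p (j, G j))). split; [reflexivity|split; [exact SG|split; [|split]]].
  - intros j i t Hji. induction Hji as [|i Hji IH]; intros Hi.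
    + apply (Hp (j, G j) (SG j)). intros E. apply Hi. change (G j t * fst (p (j, G j)) t = 0)%C. rewrite E; ring.
    + apply IH. intros E. apply Hi. change (G i t * fst (p (i, G i)) t = 0)%C. rewrite E; ring.
  - intros j. apply (Hp (j, G j) (SG j)).
  - intros j m. apply (Hp (j, G j) (SG j)).
Qed.

(** The Fourier bound with [B = 0] annihilates a distribution without coefficients. *)
Lemma exists_nonzero_coefficient L f : cdist L -> smooth f -> L f <> RtoC 0 -> exists k, L (e k) <> RtoC 0.
Proof.
  intros HL F Hf. apply NNPP; intros Hn. apply Hf, Cmod_eq_0.
  destruct (smooth_bounded_to 3 f F) as [M [M0 HM]].
  apply Rle_antisym; [|apply Cmod_ge_0].
  replace 0 with (20 * 0 * M) by ring. apply cdist_fourier_bound; auto.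
  intros k. replace (L (e k)) with (RtoC 0); [rewrite Cmod_0; lra|].
  apply NNPP; intros K. apply Hn. exists k. auto.
Qed.

Lemma complexify_nonzero S f : complexify S f <> RtoC 0 ->
  S (fun t => fst (f t)) <> RtoC 0 \/ S (fun t => snd (f t)) <> RtoC 0.
Proof.
  intros H. apply NNPP; intros K. apply not_or_and in K. destruct K as [K1 K2].
  apply NNPP in K1, K2. apply H. unfold complexify. rewrite K1, K2. ring.
Qed.

Theorem theorem4p1 (E : C -> Prop) :
  multiplicity_set E ->
  exists mu : (R -> R) -> C,
    is_distribution mu /\ nonzero_distr mu /\
    kronecker_set (supp mu) /\ supported_by mu E /\
    (forall eps : R, 0 < eps -> exists N : Z, forall n : Z,
       (n < N)%Z -> Cmod (fourier mu n) < eps).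
Proof.
  intros [_ [S [HS [[phi0 [Tphi0 Hphi0]] [HE Hdecay]]]]].
  set (L := complexify S).
  assert (CL : cdist L) by now apply cdist_complexify.
  assert (HL : pseudofunction L).
  { split; [exact CL|]. intros eps He. destruct (Hdecay eps He) as [N HN]. exists N. intros k Hk.
    rewrite <- (Z.opp_involutive k). unfold L. rewrite complexify_e by exact HS. apply HN. lia. }
  assert (Lphi0 : L (fun t => RtoC (phi0 t)) <> RtoC 0).
  { unfold L, complexify. simpl. intros K. apply Hphi0.
    assert (Z : S (fun _ => 0) = RtoC 0).
    { destruct HS as [Lin _]. replace (fun _ : R => 0) with (fun t => 0 * phi0 t + 0 * phi0 t)
        by (apply functional_extensionality; intros; ring).
      rewrite Lin by assumption. ring. }
    rewrite Z in K. change (S phi0 + Ci * 0 = 0)%C in K. rewrite <- K. ring. }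
  destruct (exists_nonzero_coefficient L _ CL (test_fun_smooth _ Tphi0) Lphi0) as [k0 Hk0].
  (* The total change of the coefficient at [k0] is at most [4 * eta * (1 + |k0|)], half of its
     modulus. *)
  set (eta := Cmod (L (e k0)) / (8 * (1 + Rabs (IZR k0)))).
  pose proof (Rabs_pos (IZR k0)) as k0p.
  assert (Heta : 0 < eta) by (apply Rdiv_lt_0_compat; [now apply Cmod_gt_0|lra]).
  destruct (multiplier_sequence L eta HL Heta) as [G [n [G0 [SG [Gtask [n1 Gstep]]]]]].
  set (u := fun (f : R -> C) j => L (fun t => (G j t * f t)%C)).
  destruct CL as [Lin Lbd]. assert (CL : cdist L) by now split.
  assert (du : forall f j, smooth f -> (u f (Datatypes.S j) - u f j)%C = L (fun t => ((G (Datatypes.S j) t - G j t) * f t)%C)).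
  { intros f j F. unfold u. rewrite <- clinear_minus; auto using smooth_mult.
    apply clinear_ext; intros; ring. }
  set (ML := fun f => clim (u f)).
  assert (coef : forall j m, Cmod (u (e (- m)) (Datatypes.S j) - u (e (- m)) j) <= eta * (1 + Rabs (IZR m)) * (/ 2) ^ j).
  { intros j m. rewrite du by apply smooth_e. destruct (Gstep j m) as [_ H]. cbv zeta in H. lra. }
  assert (bound : forall f M j, smooth f -> bounded_to 3 M f -> Cmod (u f (Datatypes.S j) - u f j) <= 20 * eta * M * (/ 2) ^ j).
  { intros f M j F HM. rewrite du by exact F.
    replace (20 * eta * M * (/ 2) ^ j) with (20 * (eta * (/ 2) ^ j) * M) by ring.
    apply (cdist_fourier_bound (mulL L (fun t => (G (Datatypes.S j) t - G j t)%C))); auto.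
    - apply cdist_mulL; auto using smooth_minus.
    - intros k. destruct (Gstep j (- k)%Z) as [_ H]. cbv zeta in H.
      rewrite Z.opp_involutive, opp_IZR, Rabs_Ropp in H. exact H. }
  assert (cv : forall f, smooth f -> conv (u f) (ML f)).
  { intros f F. destruct (smooth_bounded_to 3 f F) as [M [_ HM]].
    apply (geometric_limit (u f) (20 * eta * M)). intros; now apply bound. }
  assert (MLlin : clinear ML).
  { intros f g a b F H. apply conv_unique with (u (fun t => (a * f t + b * g t)%C)).
    - apply cv. apply smooth_plus; now apply smooth_scal.
    - replace (u (fun t => (a * f t + b * g t)%C)) with (fun j => (a * u f j + b * u g j)%C).
      + apply conv_lin; now apply cv.
      + apply functional_extensionality; intros j. unfold u. rewrite <- Lin by now apply smooth_mult.
        apply clinear_ext; intros; ring. }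
  assert (u0 : forall f, u f O = L f) by (intros f; apply clinear_ext; intros; rewrite G0; ring).
  set (mu := fun phi : R -> R => ML (fun t => RtoC (phi t))).
  assert (mu_dist : is_distribution mu).
  { split.
    - intros phi psi a b Hp Hq. unfold mu. rewrite <- MLlin by now apply test_fun_smooth.
      apply clinear_ext; intros. now rewrite RtoC_plus, !RtoC_mult.
    (* The order is that of [L] plus 3 for the corrections, and 80 is 4 from the geometric limit
       times 20. *)
    - destruct Lbd as [K [k [K0 HK]]]. exists (K + 80 * eta), (k + 3)%nat. intros phi M Tp HM.
      assert (B : bounded_to (k + 3) M (fun t => RtoC (phi t))).
      { intros j t Hj. rewrite Dn_RtoC, Cmod_R. now apply HM. }
      pose proof (test_fun_smooth _ Tp) as Sp.
      assert (B3 := bounded_to_le 3 (k + 3) _ _ ltac:(lia) B).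
      assert (Bk := bounded_to_le k (k + 3) _ _ ltac:(lia) B).
      destruct (geometric_limit (u (fun t => RtoC (phi t))) (20 * eta * M)) as [_ H];
        [intros; now apply bound|].
      specialize (H O). rewrite u0 in H. simpl pow in H. specialize (HK _ _ Sp Bk).
      unfold mu, ML. set (z := clim _) in *. set (w := L _) in *.
      pose proof (Cmod_triangle (z - w) w) as T. replace (z - w + w)%C with z in T by ring. lra. }
  assert (mu_fourier : forall m, fourier mu m = ML (e (- m))).
  { intros m. rewrite <- complexify_e by exact mu_dist. unfold complexify, mu.
    destruct (smooth_test_fun _ (smooth_e (- m))) as [T1 T2].
    rewrite <- clinear_scal, <- clinear_plus; auto using smooth_scal, test_fun_smooth.
    apply clinear_ext; intros t. apply injective_projections; simpl; ring. }
  (* A nonzero limit has nonzero terms beyond every index, so any [G j] with [j] as late as desired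
     may be used to locate the support. *)
  assert (mu_supp : forall phi, test_fun phi -> mu phi <> RtoC 0 ->
     forall J, exists j, (J <= j)%nat /\ L (fun t => (G j t * RtoC (phi t))%C) <> RtoC 0).
  { intros phi Tp Hphi J. apply NNPP; intros K. apply Hphi.
    apply conv_unique with (u (fun t => RtoC (phi t))); [apply cv; now apply test_fun_smooth|].
    intros eps He. exists J. intros j Hj. replace (u _ j) with (RtoC 0).
    - replace (0 - 0)%C with (RtoC 0) by ring. now rewrite Cmod_0.
    - apply NNPP; intros Hne. apply K. exists j. split; [exact Hj|]. intros E0. apply Hne. now rewrite <- E0. }
  exists mu. split; [exact mu_dist|split; [|split; [|split]]].
  - assert (Hf : fourier mu (- k0) <> RtoC 0).
    { rewrite mu_fourier. intros K.
      destruct (geometric_limit (u (e (- - k0))) (eta * (1 + Rabs (IZR (- k0))))) as [_ H]; [intros; apply coef|].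
      specialize (H O). rewrite u0 in H. unfold ML in K. rewrite K in H. rewrite Z.opp_involutive, opp_IZR, Rabs_Ropp in H.
      replace (0 - L (e k0))%C with (- L (e k0))%C in H by ring. rewrite Cmod_opp in H.
      replace (4 * (eta * (1 + Rabs (IZR k0))) * (/ 2) ^ 0) with (Cmod (L (e k0)) / 2) in H
        by (unfold eta; simpl; field; lra).
      apply Cmod_gt_0 in Hk0. lra. }
    rewrite <- complexify_e in Hf by exact mu_dist.
    destruct (smooth_test_fun _ (smooth_e (- - k0))) as [T1 T2].
    apply complexify_nonzero in Hf. destruct Hf as [Hf|Hf].
    + eexists; split; [exact T1|exact Hf].
    + eexists; split; [exact T2|exact Hf].
  - apply kronecker_of_tasks; [apply closed_supp|]. intros j. exists (n j). intros z Hz.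
    destruct (supp_circle_angle _ _ Hz) as [x [_ Ex]]. destruct Hz as [_ Hz].
    set (q := task_scale j). assert (q0 : 0 < INR q) by (apply lt_0_INR; unfold q, task_scale; lia).
    assert (iq : 0 < / INR q) by now apply Rinv_0_lt_compat.
    assert (nj : 1 <= INR (n j)) by (change 1 with (INR 1); apply le_INR, n1).
    (* The map [z^n] is n-Lipschitz on the circle, so at this distance both conditions pass from [t]
       to [z] at an extra cost of [2 / q], which explains the 4 in [kronecker_of_tasks]. *)
    destruct (Hz (2 / INR q / INR (n j))) as [phi [Tp [Vp Np]]]; [repeat apply Rdiv_lt_0_compat; lra|].
    destruct (mu_supp phi Tp Np (Datatypes.S j)) as [i [Hi Li]].
    assert (Ht : exists t, (G i t * RtoC (phi t))%C <> RtoC 0).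
    { apply NNPP; intros K. apply Li. rewrite (clinear_ext L _ (fun _ => RtoC 0)); [now apply clinear_0|].
      intros t. apply NNPP; intros K'. apply K. now exists t. }
    destruct Ht as [t Ht].
    assert (Gt : G i t <> RtoC 0) by (intros K; apply Ht; rewrite K; ring).
    assert (near : Cmod (eit t - z) < 2 / INR q / INR (n j)).
    { apply Rnot_le_lt; intros K. apply Ht. rewrite (Vp t K). ring. }
    destruct (Gtask j i t Hi Gt) as [r [Hr [H1 H2]]]. fold q in H1, H2, Hr.
    exists r. split; [exact Hr|]. fold q.
    assert (np : Cmod (Zpow z (Z.of_nat (n j)) - e (Z.of_nat (n j)) t) <= 2 / INR q).
    { rewrite Ex, Zpow_eit. rewrite Ex in near.
      assert (P : forall k, Cmod (e (Z.of_nat k) x - e (Z.of_nat k) t) <= INR k * Cmod (eit t - eit x)).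
      { induction k as [|k IH].
        - simpl. rewrite !e_0. replace (1 - 1)%C with (RtoC 0) by ring. rewrite Cmod_0. lra.
        - replace (Z.of_nat (Datatypes.S k)) with (Z.of_nat k + 1)%Z by lia. rewrite !e_plus, S_INR.
          replace (e (Z.of_nat k) x * e 1 x - e (Z.of_nat k) t * e 1 t)%C
            with ((e (Z.of_nat k) x - e (Z.of_nat k) t) * e 1 x + e (Z.of_nat k) t * (e 1 x - e 1 t))%C by ring.
          eapply Rle_trans; [apply Cmod_triangle|]. rewrite !Cmod_mult, !Cmod_e.
          change (e 1 x) with (eit (1 * x)). change (e 1 t) with (eit (1 * t)).
          rewrite !(Rmult_1_l x), !(Rmult_1_l t), (Cmod_minus_sym (eit x) (eit t)). lra. }
      eapply Rle_trans; [apply P|].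
      apply Rle_trans with (INR (n j) * (2 / INR q / INR (n j))); [apply Rmult_le_compat_l; lra|].
      right; field; lra. }
    assert (near' : 2 / INR q / INR (n j) <= 2 / INR q).
    { apply Rle_div_l; [lra|]. unfold Rdiv. nra. }
    split.
    + pose proof (Cmod_triangle_mid z (eit t) (eit (INR r / INR q))) as T. rewrite (Cmod_minus_sym z (eit t)) in T.
      unfold Rdiv in *. lra.
    + pose proof (Cmod_triangle_mid (Zpow z (Z.of_nat (n j))) (e (Z.of_nat (n j)) t) (eit (INR (task_target j r) / INR q))) as T.
      unfold Rdiv in *. lra.
  - intros z [Cz Hz]. apply HE. split; [exact Cz|]. intros eps He.
    destruct (Hz eps He) as [phi [Tp [Vp Np]]].
    (* [G j * phi] vanishes wherever [phi] does, and its real or imaginary part is a test function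
       detected by [S]. *)
    destruct (mu_supp phi Tp Np O) as [j [_ Lj]].
    destruct (smooth_test_fun _ (smooth_mult _ _ (SG j) (test_fun_smooth _ Tp))) as [T1 T2].
    apply complexify_nonzero in Lj. destruct Lj as [Lj|Lj]; eexists; (split; [|split; [|exact Lj]]); auto.
    + intros t Ht. simpl. rewrite (Vp t Ht). ring.
    + intros t Ht. simpl. rewrite (Vp t Ht). ring.
  - intros eps He.
    (* The remaining changes after stage [j] total at most [4 * eta * (/ 2) ^ j < eps / 2],
       uniformly over [m <= 0]; the finite product [G j] times [L] is still a pseudofunction and
       handles the rest. *)
    destruct (pow_lt_1_zero (/ 2)) with (y := eps / (8 * eta)) as [j Hj];
      [rewrite Rabs_pos_eq; lra|apply Rdiv_lt_0_compat; lra|].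
    specialize (Hj j (le_n j)). assert (hp : 0 < (/ 2) ^ j) by (apply pow_lt; lra).
    rewrite Rabs_pos_eq in Hj by lra. apply Rlt_div_r in Hj; [|lra].
    destruct (pseudofunction_mulL L (G j) HL (SG j)) as [_ Hd].
    destruct (Hd (eps / 2)) as [N HN]; [lra|].
    exists (- Z.of_nat N)%Z. intros m Hm. rewrite mu_fourier.
    destruct (geometric_limit (u (e (- m))) eta) as [_ H].
    { intros i. rewrite du by apply smooth_e. apply Gstep. lia. }
    specialize (H j). specialize (HN (- m)%Z ltac:(lia)).
    change (mulL L (G j) (e (- m))) with (u (e (- m)) j) in HN.
    unfold ML. set (z := clim _) in *. set (w := u (e (- m)) j) in *.
    pose proof (Cmod_triangle (z - w) w) as T. replace (z - w + w)%C with z in T by ring. lra.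
Qed.
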